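(* Let $\alpha:\mathbb{R}^n\to[\rho,+\infty)$, $\rho>0$, be a bounded piecewise Lipschitz velocity as described in the context, and let $u_0\in C(\mathbb{R}^n)$ satisfy $$\{u_0>0\}\ne\emptyset,\quad\{u_0<0\}\ne\emptyset,\quad \{u_0=0\}=\partial\{u_0>0\}=\partial\{u_0<0\}.$$ Let $u\in C(\mathbb{R}^n\times[0,+\infty))$ be the unique continuous viscosity solution of $u_t+\alpha(x)|Du|=0$ in $\mathbb{R}^n\times(0,+\infty)$, $u(x,0)=u_0(x)$. Then the zero level set of $u$ satisfies the no-interior condition $$\{(x,t):u(x,t)=0\}=\partial\{(x,t):u(x,t)>0\}=\partial\{(x,t):u(x,t)<0\}.$$
   Context: Velocity. $\tilde\Gamma\subset\mathbb{R}^n$ is an oriented, closed, Lipschitz hypersurface (a finite union of connected Lipschitz hypersurfaces), $\tilde d$ a signed distance function from $\tilde\Gamma$; $n_1,n_2:\mathbb{R}^n\to[\rho,+\infty)$ are bounded and locally Lipschitz with $n_1<n_2$ everywhere; $\alpha$ is measurable with $\alpha(x)=n_1(x)$ if $\tilde d(x)<0$, $\alpha(x)=n_2(x)$ if $\tilde d(x)>0$, $\alpha(x)\in[n_1(x),n_2(x)]$ if $\tilde d(x)=0$. $\alpha^*,\alpha_*$ are the upper and lower semicontinuous envelopes of $\alpha$. Viscosity solutions (in the sense of Ishii). A continuous $u$ is a viscosity solution of $u_t+\alpha(x)|Du|=0$ if it satisfies, in the viscosity sense, $u_t+\alpha_*(x)|Du|\le0$ and $u_t+\alpha^*(x)|Du|\ge0$.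 For every continuous initial datum there is a unique continuous solution of the Cauchy problem (known). Sets $\{(x,t):\dots\}$ are subsets of $\mathbb{R}^n\times[0,+\infty)$, and their boundaries are taken relative to this space. *)

(* Defs.v *)
(* MathComp / MathComp-Analysis.  R^n is 'rV[R]_n and R^n x R is the product
   'rV[R]_n * R.  Their library topologies (sup norm) are the usual ones; the
   Euclidean norm, needed for |Du| and for distances, is [enorm]. *)
From HB Require Import structures.
From mathcomp Require Import all_boot all_order all_algebra.
From mathcomp Require Import all_classical all_reals all_analysis.

Set Implicit Arguments.
Unset Strict Implicit.
Unset Printing Implicit Defensive.

Import Order.TTheory GRing.Theory Num.Theory.
Import numFieldNormedType.Exports.

Local Open Scope classical_set_scope.
Local Open Scope ring_scope.

Section Topology.

Definition boundary (T : topologicalType) (A : set T) : set T :=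
  closure A `\` interior A.

(* [subspace S] isolates the points outside S, so for A included in S this is
   the boundary of A as a subset of the topological space S. *)
Definition boundary_in (T : topologicalType) (S A : set T) : set T :=
  @boundary (subspace S) A.

End Topology.

Section Euclidean.
Context {R : realType} {n : nat}.
Implicit Types (x y e : 'rV[R]_n) (A B : set 'rV[R]_n).

Definition dot x y : R := \sum_i x 0 i * y 0 i.
Definition enorm x : R := Num.sqrt (dot x x).

(* Equal to 0 for A = set0; only used for nonempty A. *)
Definition dist_to A x : R := inf [set enorm (x - y) | y in A].

Definition lebesgue_null A : Prop :=
  forall eps : R, 0 < eps -> exists a b : nat -> 'rV[R]_n,
    [/\ forall k i, a k 0 i <= b k 0 i,
        A `<=` \bigcup_k [set x | forall i, a k 0 i <= x 0 i <= b k 0 i] &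
        forall m, \sum_(k < m) \prod_i (b k 0 i - a k 0 i) <= eps].

Definition lebesgue_measurable A : Prop :=
  exists B, <<s open >> B /\ lebesgue_null ((A `\` B) `|` (B `\` A)).

Definition lebesgue_measurable_fun (f : 'rV[R]_n -> R) : Prop :=
  forall c : R, lebesgue_measurable [set x | c < f x].

End Euclidean.

Section Hypersurface.
Context {R : realType} {n : nat}.
Implicit Types (G S Om : set 'rV[R]_n).

Definition proj_perp (e x : 'rV[R]_n) : 'rV[R]_n := x - dot x e *: e.

(* Near each of its points S is the graph, in the direction of a unit vector e,
   of a Lipschitz function g on the hyperplane orthogonal to e.  Only the values
   of g on that hyperplane matter: a Lipschitz function on the hyperplane extends
   to R^n by composition with [proj_perp e]. *)
Definition lipschitz_hypersurface S : Prop :=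
  S !=set0 /\
  forall x, S x -> exists (e : 'rV[R]_n) (g : 'rV[R]_n -> R),
    [/\ enorm e = 1, [lipschitz g y | y in setT] &
        \forall y \near x, S y <-> dot y e = g (proj_perp e y)].

Definition finite_union_of_connected_hypersurfaces G : Prop :=
  exists (k : nat) (S : 'I_k -> set 'rV[R]_n),
    (forall i, connected (S i) /\ lipschitz_hypersurface (S i)) /\
    G = \bigcup_i S i.

(* An orientation of G is given by its negative side, an open set Om; the positive
   side is ~` closure Om, and G is the full boundary of each of the two sides. *)
Definition orients Om G : Prop :=
  [/\ open Om, boundary Om = G & boundary (~` closure Om) = G].

Definition signed_dist G Om (x : 'rV[R]_n) : R :=
  if x \in Om then - dist_to G x else dist_to G x.

Record oriented_closed_lipschitz_hypersurface G Om : Prop := {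
  hyp_lipschitz : lipschitz_hypersurface G;
  hyp_closed : closed G;
  hyp_finite : finite_union_of_connected_hypersurfaces G;
  hyp_oriented : orients Om G }.

End Hypersurface.

Section Velocity.
Context {R : realType} {n : nat}.
Implicit Types G Om : set 'rV[R]_n.

Record piecewise_lipschitz_velocity (rho : R) G Om
    (n1 n2 alpha : 'rV[R]_n -> R) : Prop := {
  vel_hypersurface : oriented_closed_lipschitz_hypersurface G Om;
  vel_n1_ge : forall x, rho <= n1 x;
  vel_n2_ge : forall x, rho <= n2 x;
  vel_n1_bounded : [bounded n1 x | x in setT];
  vel_n2_bounded : [bounded n2 x | x in setT];
  vel_n1_lipschitz : [locally [lipschitz n1 x | x in setT]];
  vel_n2_lipschitz : [locally [lipschitz n2 x | x in setT]];
  vel_n1_lt_n2 : forall x, n1 x < n2 x;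
  vel_ge : forall x, rho <= alpha x;
  vel_bounded : [bounded alpha x | x in setT];
  vel_measurable : lebesgue_measurable_fun alpha;
  vel_neg : forall x, signed_dist G Om x < 0 -> alpha x = n1 x;
  vel_pos : forall x, 0 < signed_dist G Om x -> alpha x = n2 x;
  vel_zero : forall x, signed_dist G Om x = 0 -> n1 x <= alpha x <= n2 x }.

(* [nbhs x] is not punctured, so these are the semicontinuous envelopes; they are
   meaningful for locally bounded f, for which the extended limits are finite. *)
Definition usc_envelope (f : 'rV[R]_n -> R) (x : 'rV[R]_n) : R :=
  fine (limf_esup (EFin \o f) (nbhs x)).
Definition lsc_envelope (f : 'rV[R]_n -> R) (x : 'rV[R]_n) : R :=
  fine (limf_einf (EFin \o f) (nbhs x)).

End Velocity.

Section Viscosity.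
Context {R : realType} {n : nat}.
Implicit Types (phi u : 'rV[R]_n * R -> R) (p q : 'rV[R]_n * R).

Definition time_derive phi p : R := 'D_((0, 1) : 'rV[R]_n * R) phi p.
Definition space_gradient phi p : 'rV[R]_n :=
  \row_i 'D_((delta_mx 0 i, 0) : 'rV[R]_n * R) phi p.

Definition closed_half : set ('rV[R]_n * R) := [set p | 0 <= p.2].
Definition open_half : set ('rV[R]_n * R) := [set p | 0 < p.2].

(* For an open set A. *)
Definition C1_on (A : set ('rV[R]_n * R)) phi : Prop :=
  forall p, A p -> differentiable phi p /\
    forall v : 'rV[R]_n * R, {for p, continuous (fun q => 'D_v phi q)}.

Definition viscosity_subsolution (beta : 'rV[R]_n -> R) u : Prop :=
  forall phi, C1_on open_half phi -> forall p, open_half p ->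
    (\forall q \near p, u q - phi q <= u p - phi p) ->
    time_derive phi p + beta p.1 * enorm (space_gradient phi p) <= 0.

Definition viscosity_supersolution (beta : 'rV[R]_n -> R) u : Prop :=
  forall phi, C1_on open_half phi -> forall p, open_half p ->
    (\forall q \near p, u p - phi p <= u q - phi q) ->
    0 <= time_derive phi p + beta p.1 * enorm (space_gradient phi p).

(* The values of u at negative times are irrelevant. *)
Record cauchy_viscosity_solution (alpha u0 : 'rV[R]_n -> R) u : Prop := {
  sol_continuous : {within closed_half, continuous u};
  sol_sub : viscosity_subsolution (lsc_envelope alpha) u;
  sol_super : viscosity_supersolution (usc_envelope alpha) u;
  sol_init : forall x, u (x, 0) = u0 x }.

End Viscosity.

(* Main.v *)
(* Since the velocity is at least rho > 0, u is nonincreasing along the directions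
   of the cone |x - y| <= rho (t - s).  Hence {u < 0} and {u <= 0} are the sets
   above the graphs of two Lipschitz arrival times S >= T, and the no-interior
   condition amounts to S = T.  Testing u with steep functions of a function that
   touches the front shows that S is a subsolution and T a supersolution of the
   eikonal equation alpha |D S| = 1, and the assumption on u0 gives S = 0 where T = 0.
   The comparison S <= T for the discontinuous alpha doubles the variables with a
   penalization of x - y - eps eta, where eta is transversal to the interface and
   points to its fast side: then either y lies on the slow side or x on the fast
   side, so that alpha^*(y) <= alpha_*(x) + C |x - y|. *)
Require Import Defs.
From HB Require Import structures.
From mathcomp Require Import all_boot all_order all_algebra.
From mathcomp Require Import all_classical all_reals all_analysis.
From mathcomp Require Import ring lra.

Set Implicit Arguments.
Unset Strict Implicit.
Unset Printing Implicit Defensive.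

Import Order.TTheory GRing.Theory Num.Theory.
Import numFieldNormedType.Exports.

Local Open Scope classical_set_scope.
Local Open Scope ring_scope.

(** The steep tests give the eikonal inequality only at some point near the contact point, so every
    condition used with it must survive small displacements. This is why the crossing condition
    tolerates an error [c0 * eps] in the shift, of which the doubling spends only half.

    The comparison is made between exp(-T) and exp(-S). They are bounded, so a quadratic term
    suffices for a maximum on the whole space, and the equation alpha |Dw| = w which they inherit
    makes the difference of values at a positive maximum bounded by the difference of Hamiltonians.

    The localized maximum [xh] is fixed before the variables are doubled, so the direction eta and
    all constants of the velocity are needed near [xh] alone, without uniformity along the
    interface. The doubling penalty has a coefficient of order 1 / eps: the Lipschitz bounds of the
    arrival times keep its slope bounded, and the error C |x - y| times that slope vanishes with the
    scale. *)

Section EuclideanSpace.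
Context {R : realType} {n : nat}.
Implicit Types (x y z b : 'rV[R]_n) (a r : R).

(** * Euclidean inner product, norm and neighbourhoods *)

Lemma dotC x y : dot x y = dot y x.
Proof. by apply: eq_bigr => i _; rewrite mulrC. Qed.

Lemma dotDl x y z : dot (x + y) z = dot x z + dot y z.
Proof. by rewrite -big_split; apply: eq_bigr => i _; rewrite mxE mulrDl. Qed.

Lemma dotZl a x z : dot (a *: x) z = a * dot x z.
Proof. by rewrite mulr_sumr; apply: eq_bigr => i _; rewrite mxE mulrA. Qed.

Lemma dotNl x z : dot (- x) z = - dot x z.
Proof. by rewrite -scaleN1r dotZl mulN1r. Qed.

Lemma dotBl x y z : dot (x - y) z = dot x z - dot y z.
Proof. by rewrite dotDl dotNl. Qed.

Lemma dotDr x y z : dot z (x + y) = dot z x + dot z y.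
Proof. by rewrite dotC dotDl !(dotC z). Qed.

Lemma dotZr a x z : dot z (a *: x) = a * dot z x.
Proof. by rewrite dotC dotZl (dotC z). Qed.

Lemma dotNr x z : dot z (- x) = - dot z x.
Proof. by rewrite dotC dotNl (dotC z). Qed.

Lemma dotBr x y z : dot z (x - y) = dot z x - dot z y.
Proof. by rewrite dotDr dotNr. Qed.

Lemma dot0l x : dot 0 x = 0.
Proof. by rewrite -(scale0r x) dotZl mul0r. Qed.

Lemma dot0r x : dot x 0 = 0.
Proof. by rewrite dotC dot0l. Qed.

Definition dotE := (dotDl, dotDr, dotBl, dotBr, dotZl, dotZr, dotNl, dotNr, dot0l, dot0r).

Lemma dot_ge0 x : 0 <= dot x x.
Proof. by apply: sumr_ge0 => i _; exact: sqr_ge0. Qed.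

Lemma enorm_ge0 x : 0 <= enorm x.
Proof. exact: sqrtr_ge0. Qed.

Lemma enorm_sqr x : enorm x ^+ 2 = dot x x.
Proof. by rewrite sqr_sqrtr // dot_ge0. Qed.

Lemma enorm0 : enorm (0 : 'rV[R]_n) = 0.
Proof. by rewrite /enorm dot0l sqrtr0. Qed.

Lemma enormZ a x : enorm (a *: x) = `|a| * enorm x.
Proof.
by rewrite /enorm dotZl dotZr mulrA -expr2 sqrtrM ?sqr_ge0 // sqrtr_sqr.
Qed.

Lemma enormN x : enorm (- x) = enorm x.
Proof. by rewrite -scaleN1r enormZ normrN1 mul1r. Qed.

Lemma enormC x y : enorm (x - y) = enorm (y - x).
Proof. by rewrite -enormN opprB. Qed.

Lemma coord_le_enorm x i : `|x 0 i| <= enorm x.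
Proof.
rewrite -sqrtr_sqr ler_wsqrtr // /dot (bigD1 i) //= -expr2 lerDl.
by apply: sumr_ge0 => j _; exact: sqr_ge0.
Qed.

Lemma enorm_eq0 x : enorm x = 0 -> x = 0.
Proof.
move=> x0; apply/rowP => i; rewrite mxE; apply/eqP.
by rewrite -normr_le0 -x0 coord_le_enorm.
Qed.

Lemma dot_le_enorm x y : dot x y <= enorm x * enorm y.
Proof.
have [y0|y0] := eqVneq (enorm y) 0; first by rewrite (enorm_eq0 y0) dot0r enorm0 mulr0.
have [x0|x0] := eqVneq (enorm x) 0; first by rewrite (enorm_eq0 x0) dot0l enorm0 mul0r.
have xp : 0 < enorm x by rewrite lt_neqAle eq_sym x0 enorm_ge0.
have yp : 0 < enorm y by rewrite lt_neqAle eq_sym y0 enorm_ge0.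
(* The square expands to 2 |x| |y| (|x| |y| - x.y), and the prefactor is positive. *)
have := dot_ge0 ((enorm y) *: x - (enorm x) *: y).
rewrite !dotE -!enorm_sqr (dotC y x) => H.
have : 0 <= 2 * (enorm x * enorm y) * (enorm x * enorm y - dot x y).
  by rewrite (le_trans H) //; nra.
by rewrite pmulr_rge0 ?subr_ge0 // !mulr_gt0.
Qed.

Lemma enorm_triangle x y : enorm (x + y) <= enorm x + enorm y.
Proof.
rewrite -(@ler_pXn2r _ 2) ?nnegrE ?addr_ge0 ?enorm_ge0 //.
have := dot_le_enorm x y; rewrite enorm_sqr !dotE sqrrD !enorm_sqr (dotC y x).
by move=> H; lra.
Qed.

Lemma enorm_triangleB x y : enorm (x - y) <= enorm x + enorm y.
Proof. by rewrite -(enormN y) enorm_triangle. Qed.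

Lemma enorm_dist_triangle y x z : enorm (x - z) <= enorm (x - y) + enorm (y - z).
Proof. by rewrite (_ : x - z = (x - y) + (y - z)) ?enorm_triangle // addrA subrK. Qed.

Lemma enorm_dist_ge x y : enorm x - enorm y <= enorm (x - y).
Proof. by rewrite lerBlDr -{1}(subrK y x) enorm_triangle. Qed.

Lemma enorm_le_coord x r : (forall i, `|x 0 i| <= r) -> 0 <= r -> enorm x <= n%:R * r.
Proof.
move=> xr r0; rewrite -(@ler_pXn2r _ 2) ?nnegrE ?mulr_ge0 ?enorm_ge0 //.
rewrite enorm_sqr /dot; apply: (@le_trans _ _ (\sum_(i < n) r ^+ 2)).
  apply: ler_sum => i _; rewrite -expr2 -real_normK ?num_real //.
  by rewrite ler_pXn2r ?nnegrE.
rewrite sumr_const card_ord -(mulr_natl (r ^+ 2)) exprMn.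
apply: ler_wpM2r; first exact: sqr_ge0.
by rewrite -natrX ler_nat; case: (n) => // m; rewrite leq_pmulr.
Qed.

Lemma nbhs_enormP x (P : set 'rV[R]_n) :
  nbhs x P <-> exists2 r, 0 < r & forall y, enorm (y - x) < r -> P y.
Proof.
split=> [/nbhs_ballP[r /= r0 rP]|[r r0 rP]].
  exists r => // y xy; apply: rP; split=> // i j.
  rewrite (ord1 i) /ball /= (le_lt_trans _ xy) // distrC.
  by have := coord_le_enorm (y - x) j; rewrite !mxE.
(* [n.+1] makes the bound strict and keeps the division meaningful for n = 0. *)
apply/nbhs_ballP; exists (r / n.+1%:R) => /=; first by rewrite divr_gt0.
move=> y [_ xy]; apply: rP.
apply: (@le_lt_trans _ _ (n%:R * (r / n.+1%:R))).
  apply: enorm_le_coord; last by rewrite divr_ge0 ?ltW.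
  by move=> i; have := ltW (xy 0 i); rewrite /ball /= distrC !mxE.
by rewrite mulrCA gtr_pMr // ltr_pdivrMr // mul1r ltr_nat.
Qed.

Lemma nbhs_enorm_timeP (p : 'rV[R]_n * R) (P : set ('rV[R]_n * R)) :
  nbhs p P <-> exists2 r, 0 < r &
    forall q, enorm (q.1 - p.1) < r -> `|q.2 - p.2| < r -> P q.
Proof.
split=> [/nbhs_ballP[r /= r0 rP]|[r r0 rP]].
  have /nbhs_enormP[s s0 sP] : nbhs p.1 (ball p.1 r) by exact: nbhsx_ballx.
  exists (Order.min r s); first by rewrite lt_min r0 s0.
  move=> q; rewrite !lt_min => /andP[_ q1] /andP[q2 _]; apply: rP; split.
    exact: sP.
  by rewrite /ball /= distrC.
have /nbhs_ballP[s /= s0 sP] : nbhs p.1 [set y | enorm (y - p.1) < r].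
  by apply/nbhs_enormP; exists r.
apply/nbhs_ballP; exists (Order.min r s) => /=; first by rewrite lt_min r0 s0.
move=> q [q1 q2]; apply: rP.
  by apply: sP; apply: le_ball q1; rewrite ge_min lexx orbT.
by rewrite distrC; apply: lt_le_trans q2 _; rewrite ge_min lexx.
Qed.

Lemma cvg_dot {T : Type} (F : set_system T) {FF : Filter F}
    (f g : T -> 'rV[R]_n) x y :
  f @ F --> x -> g @ F --> y -> dot (f t) (g t) @[t --> F] --> dot x y.
Proof.
move=> fx gy; apply: (@cvg_big _ _ +%R) => [|i _]; first exact: add_continuous.
have fxi := cvg_comp _ _ fx (@coord_continuous _ _ _ 0 i x).
have gyi := cvg_comp _ _ gy (@coord_continuous _ _ _ 0 i y).
exact: cvgM.
Qed.

Lemma enorm_continuous : continuous (@enorm R n).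
Proof.
move=> x; apply: (@continuous_comp _ _ _ (fun y => dot y y) Num.sqrt).
  by exact: (cvg_dot (@cvg_id _ (nbhs x)) (@cvg_id _ (nbhs x))).
exact: sqrt_continuous.
Qed.

Lemma enorm_ball_compact b r : compact [set x | enorm (x - b) <= r].
Proof.
apply: bounded_closed_compact.
  exists (r + `|b|); split; first exact: num_real.
  move=> M rM x /= xr; rewrite -(subrK b x) (le_trans (ler_normD _ _)) //.
  apply: le_trans (ltW rM); rewrite lerD2r.
  have r0 : 0 <= r by exact: le_trans (enorm_ge0 _) xr.
  rewrite [leLHS]/Num.norm /= mx_normrE; apply/bigmax_leP; split=> // ij _.
  by rewrite (ord1 ij.1) (le_trans (coord_le_enorm _ _)).
apply: (@closed_comp _ _ (fun x => enorm (x - b)) [set s | s <= r]); last exact: closed_le.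
move=> x _; apply: (@continuous_comp _ _ _ (fun y => y - b) (@enorm R n)).
  exact: (cvgB (@cvg_id _ (nbhs x)) (@cvg_cst _ b _ (nbhs x) _)).
exact: enorm_continuous.
Qed.

End EuclideanSpace.

(** * Test functions with explicit gradients *)

Section TestFunctions.
Context {R : realType} {n : nat}.
Local Notation E := ('rV[R]_n * R)%type.
Implicit Types (phi psi : E -> R) (gx hx : E -> 'rV[R]_n) (gt ht : E -> R).

(** The derivative is carried as data, split into space and time parts, so that the sum and chain
    rules compute the gradient of each test function together with its regularity. *)
Definition C1_with_gradient phi gx gt : Prop :=
  [/\ forall p : E, is_diff p phi (fun v => dot (gx p) v.1 + gt p * v.2),
      continuous gx & continuous gt].

Lemma C1_with_gradient_test phi gx gt : C1_with_gradient phi gx gt ->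
  [/\ forall A, C1_on A phi, forall p, time_derive phi p = gt p
    & forall p, space_gradient phi p = gx p].
Proof.
move=> [dphi cx ct].
have Dv (v p : E) : 'D_v phi p = dot (gx p) v.1 + gt p * v.2.
  by rewrite deriveE ?diff_val //; exact: ex_diff.
split.
- move=> A p _; split; first exact: ex_diff.
  move=> v; rewrite (_ : (fun q => _) = fun q => dot (gx q) v.1 + gt q * v.2).
    apply: cvgD; last by apply: cvgM; [exact: ct|exact: cvg_cst].
    by apply: cvg_dot; [exact: cx|exact: cvg_cst].
  by apply/funext => q; rewrite Dv.
- by move=> p; rewrite /time_derive Dv /= dot0r add0r mulr1.
- move=> p; apply/rowP => i; rewrite mxE Dv /= mulr0 addr0 /dot (bigD1 i) //=.
  rewrite mxE !eqxx mulr1 big1 ?addr0 // => j ji.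
  by rewrite mxE (negbTE ji) andbF mulr0.
Qed.

Lemma C1_gradientD phi gx gt psi hx ht :
  C1_with_gradient phi gx gt -> C1_with_gradient psi hx ht ->
  C1_with_gradient (fun p => phi p + psi p)
    (fun p => gx p + hx p) (fun p => gt p + ht p).
Proof.
move=> [dphi cx ct] [dpsi dx dt]; split.
- move=> p; have := is_diffD (dphi p) (dpsi p).
  move=> h; apply: (is_diff_eq h); apply/funext => v.
  by rewrite !fctE /= !dotE; ring.
- by move=> p; apply: cvgD; [exact: cx|exact: dx].
- by move=> p; apply: cvgD; [exact: ct|exact: dt].
Qed.

Lemma C1_gradientN phi gx gt : C1_with_gradient phi gx gt ->
  C1_with_gradient (fun p => - phi p) (fun p => - gx p) (fun p => - gt p).
Proof.
move=> [dphi cx ct]; split.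
- move=> p; apply: (is_diff_eq (is_diffN (dphi p))); apply/funext => v.
  by rewrite !fctE /= !dotE; ring.
- by move=> p; apply: cvgN; exact: cx.
- by move=> p; apply: cvgN; exact: ct.
Qed.

Lemma C1_gradient_cst (c : R) :
  C1_with_gradient (fun=> c) (fun=> 0) (fun=> 0).
Proof.
split; try by move=> p; exact: cvg_cst.
move=> p; apply: (is_diff_eq (is_diff_cst c p)).
by apply/funext => v; rewrite /= dot0l mul0r addr0.
Qed.

Lemma C1_gradient_sum (I : Type) (s : seq I) (phi : I -> E -> R) (gx : I -> E -> 'rV[R]_n)
    (gt : I -> E -> R) :
  (forall i, C1_with_gradient (phi i) (gx i) (gt i)) ->
  C1_with_gradient (fun p => \sum_(i <- s) phi i p)
    (fun p => \sum_(i <- s) gx i p) (fun p => \sum_(i <- s) gt i p).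
Proof.
move=> dphi; elim: s => [|i s IHs].
  under [X in C1_with_gradient X]funext do rewrite big_nil.
  under [X in C1_with_gradient _ X]funext do rewrite big_nil.
  under [X in C1_with_gradient _ _ X]funext do rewrite big_nil.
  exact: C1_gradient_cst.
under [X in C1_with_gradient X]funext do rewrite big_cons.
under [X in C1_with_gradient _ X]funext do rewrite big_cons.
under [X in C1_with_gradient _ _ X]funext do rewrite big_cons.
exact: C1_gradientD.
Qed.

Lemma C1_gradient_comp (h h' : R -> R) phi gx gt :
  (forall s : R, is_derive s 1 h (h' s)) -> continuous h' ->
  C1_with_gradient phi gx gt ->
  C1_with_gradient (fun p => h (phi p))
    (fun p => h' (phi p) *: gx p) (fun p => h' (phi p) * gt p).
Proof.
move=> dh ch' [dphi cx ct].
have cphi : continuous phi.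
  by move=> p; apply: differentiable_continuous; exact: ex_diff.
split.
- move=> p.
  have dhp : is_diff (phi p) h (fun s => s * h' (phi p)).
    have dd : differentiable h (phi p) by apply/derivable1_diffP; exact: ex_derive.
    have -> : (fun s => s * h' (phi p)) = 'd h (phi p).
      apply/funext => s; rewrite diff1E // derive1E.
      by rewrite (@derive_val _ _ _ _ _ _ _ (dh (phi p))).
    exact: differentiableP.
  apply: (is_diff_eq (is_diff_comp (dphi p) dhp)).
  by apply/funext => v /=; rewrite dotZl; ring.
- move=> p; apply: cvgZ; last exact: cx.
  by apply: continuous_comp; [exact: cphi|exact: ch'].
- move=> p; apply: cvgM; last exact: ct.
  by apply: continuous_comp; [exact: cphi|exact: ch'].
Qed.

Lemma C1_gradient_linear (L : E -> R) b c :
  (forall p, L p = dot b p.1 + c * p.2) ->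
  C1_with_gradient L (fun=> b) (fun=> c).
Proof.
move=> LE.
have linL : linear L by move=> k p q; rewrite !LE /= !dotE /GRing.scale /=; ring.
pose L' : {linear E -> R} := HB.pack L (GRing.isLinear.Build _ _ _ _ L linL).
have cL : continuous L'.
  move=> p; rewrite /L' /= (_ : L = fun p => dot b p.1 + c * p.2); last exact/funext.
  apply: cvgD; last by apply: cvgM; [exact: cvg_cst|exact: cvg_snd].
  by apply: cvg_dot; [exact: cvg_cst|exact: cvg_fst].
split; try by move=> p; exact: cvg_cst.
move=> p; have : is_diff p L' L'.
  apply: DiffDef; first exact: linear_differentiable.
  exact: diff_lin.
by move=> h; apply: (is_diff_eq h); apply/funext => q; exact: LE.
Qed.

(** The centre [a + t v] moves with velocity [v]; [v = 0] gives a purely spatial square distance.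
    Each coordinate of [z] is affine, so only the chain rule for squares is needed. *)
Lemma C1_gradient_sqr_dist (a v : 'rV[R]_n) :
  let z (p : E) := p.1 - a - p.2 *: v in
  C1_with_gradient (fun p => dot (z p) (z p))
    (fun p => 2 *: z p) (fun p => - 2 * dot (z p) v).
Proof.
move=> z.
have sqr_derive (s : R) : is_derive s 1 (fun r : R => r ^+ 2) (2 * s).
  apply: DeriveDef; first exact: exprn_derivable.
  by rewrite exp_derive /GRing.scale /= mulr1.
have coord i : C1_with_gradient (fun p => z p 0 i)
    (fun=> delta_mx 0 i) (fun=> - v 0 i).
  have dotdelta (x : 'rV[R]_n) : dot (delta_mx 0 i) x = x 0 i.
    rewrite /dot (bigD1 i) //= mxE !eqxx mul1r big1 ?addr0 // => j ji.
    by rewrite mxE (negbTE ji) andbF mul0r.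
  have lin : C1_with_gradient (fun p : E => p.1 0 i - p.2 * v 0 i)
      (fun=> delta_mx 0 i) (fun=> - v 0 i).
    by apply: C1_gradient_linear => p; rewrite dotdelta; ring.
  have := C1_gradientD lin (C1_gradient_cst (- a 0 i)).
  rewrite !addr0 (_ : (fun p : E => _) = fun p => z p 0 i) //.
  by apply/funext => p; rewrite /z !mxE; ring.
have := C1_gradient_sum (index_enum 'I_n)
  (fun i => C1_gradient_comp sqr_derive (@mulrl_continuous _ 2) (coord i)).
congr C1_with_gradient; apply/funext => p.
- rewrite [in RHS](row_sum_delta (z p)) scaler_sumr.
  by apply: eq_bigr => i _; rewrite scalerA.
- by rewrite /dot mulr_sumr; apply: eq_bigr => i _; ring.
Qed.

End TestFunctions.

(** * Monotonicity of subsolutions along the cone of speed [rho] *)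

Section ConeMonotonicity.
Context {R : realType} {n : nat}.
Local Notation E := ('rV[R]_n * R)%type.

Definition cylinder (b : 'rV[R]_n) (r t0 t1 : R) : set E :=
  [set p | enorm (p.1 - b) <= r /\ t0 <= p.2 <= t1].

Lemma cylinder_compact b r t0 t1 : compact (cylinder b r t0 t1).
Proof.
rewrite (_ : cylinder b r t0 t1 =
  [set x | enorm (x - b) <= r] `*` `[t0, t1]).
  by apply: compact_setX; [exact: enorm_ball_compact|exact: segment_compact].
by apply/seteqP; split=> p; rewrite /cylinder /= in_itv.
Qed.

Lemma cylinder_max (f phi : E -> R) (A : set E) b r t0 t1 :
  {within A, continuous f} -> continuous phi -> cylinder b r t0 t1 `<=` A ->
  cylinder b r t0 t1 !=set0 ->
  exists2 p, cylinder b r t0 t1 p &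
    forall q, cylinder b r t0 t1 q -> f q - phi q <= f p - phi p.
Proof.
move=> cf cphi KA K0.
have [|p pK pmax] := compact_EVT_max (f := fun q => f q - phi q) K0
  (@cylinder_compact b r t0 t1).
  move=> q; apply: continuousB; first exact: (continuous_subspaceW KA cf).
  exact: (continuous_subspaceT cphi).
exists p; first by rewrite inE in pK.
by move=> q qK; apply: pmax; rewrite inE.
Qed.

Lemma cylinder_bounded (f : E -> R) (A : set E) b r t0 t1 :
  {within A, continuous f} -> cylinder b r t0 t1 `<=` A ->
  exists2 M, 0 < M & forall q, cylinder b r t0 t1 q -> `|f q| <= M.
Proof.
move=> cf KA.
have /compact_bounded/ex_strict_bound_gt0 [M M0 fM] :
    compact (f @` cylinder b r t0 t1).
  apply: continuous_compact; last exact: cylinder_compact.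
  exact: (continuous_subspaceW KA cf).
by exists M => // q qK; apply/ltW/fM; exists q.
Qed.

Lemma within_continuous_enorm (f : E -> R) (A : set E) (p : E) :
  {within A, continuous f} -> A p -> forall e, 0 < e ->
  exists2 r, 0 < r & forall q, A q -> enorm (q.1 - p.1) < r ->
    `|q.2 - p.2| < r -> `|f p - f q| < e.
Proof.
move=> cf Ap e e0.
have /cvgrPdist_lt/(_ e e0) := cf p.
rewrite [nbhs]/nbhs /= -(nbhs_subspace_in Ap) => /nbhs_enorm_timeP[r r0 rP].
by exists r => // q Aq q1 q2; exact: rP.
Qed.

Lemma cylinder_nbhs b r t0 t1 (p : E) :
  enorm (p.1 - b) < r -> t0 < p.2 < t1 -> nbhs p (cylinder b r t0 t1).
Proof.
move=> p1 /andP[p2 p3]; apply/nbhs_enorm_timeP.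
exists (Order.min (r - enorm (p.1 - b)) (Order.min (p.2 - t0) (t1 - p.2))).
  by rewrite !lt_min !subr_gt0 p1 p2 p3.
move=> q; rewrite !lt_min => /andP[q1 _] /and3P[_ q2 q3]; split.
  have := enorm_dist_triangle p.1 q.1 b; lra.
by move: q2 q3; rewrite !ltr_norml => /andP[? ?] /andP[? ?]; lra.
Qed.

(* The test function is centred on the segment from (y0, t0) to (x1, t1), whose
   speed is at most rho; its exponential term rules out a maximum at the top of
   the cylinder. *)
Lemma subsolution_cone (rho : R) (beta : 'rV[R]_n -> R) (u : E -> R)
    (x1 y0 : 'rV[R]_n) (t0 t1 : R) :
  (forall x, rho <= beta x) ->
  {within closed_half, continuous u} -> viscosity_subsolution beta u ->
  0 <= t0 <= t1 -> enorm (x1 - y0) <= rho * (t1 - t0) ->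
  u (x1, t1) <= u (y0, t0).
Proof.
move=> betage cu usub /andP[t00]; rewrite le_eqVlt => /predU1P[<-|t01].
  rewrite subrr mulr0 => xy0; suff -> : x1 = y0 by [].
  by apply/eqP; rewrite -subr_eq0; apply/eqP/enorm_eq0/le_anti; rewrite xy0 enorm_ge0.
move=> xy; rewrite leNgt; apply/negP => ult.
set d := u (x1, t1) - u (y0, t0).
have dE : d = u (x1, t1) - u (y0, t0) by [].
have d0 : 0 < d by rewrite subr_gt0.
have rho0 : 0 <= rho.
  by rewrite -(@pmulr_lge0 _ (t1 - t0)) ?subr_gt0 // (le_trans (enorm_ge0 _) xy).
pose v := (t1 - t0)^-1 *: (x1 - y0).
have vrho : enorm v <= rho.
  have tt : 0 <= (t1 - t0)^-1 by rewrite invr_ge0 subr_ge0 ltW.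
  rewrite enormZ (ger0_norm tt).
  by rewrite ler_pdivrMl ?subr_gt0 // mulrC.
pose z (p : E) := p.1 - (y0 - t0 *: v) - p.2 *: v.
have zE p : z p = p.1 - y0 - (p.2 - t0) *: v.
  by apply/rowP => i; rewrite !mxE; ring.
(* The moving centre has speed at most [rho], so on the lateral boundary it is still at distance at
   least 1, and the quadratic term is at least [C] there. *)
pose t2 := t1 + 1; pose r := rho * (t2 - t0) + 1.
pose K := cylinder y0 r t0 t2.
have KH : K `<=` closed_half.
  by move=> p [_ /andP[p2 _]]; rewrite /closed_half /= (le_trans t00).
have r0 : 0 < r by rewrite ltr_wpDl // mulr_ge0 // /t2; lra.
have Kxt : K (x1, t1).
  split=> /=; last by rewrite /t2; lra.
  by apply: (le_trans xy); rewrite /r /t2; nra.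
have Ky : K (y0, t0) by split=> /=; rewrite ?subrr ?enorm0 /t2; lra.
have [M M0 uM] := cylinder_bounded cu KH.
have [r1 r10 r1P] := within_continuous_enorm cu (KH _ Ky) (divr_gt0 d0 (ltr0Sn R 1)).
(* The two summands give [2 * M <= C], used on the lateral boundary, and [2 * M <= C * r1 ^+ 2],
   used on the bottom away from [y0]. *)
pose C := (2 * M + 1) * (1 + r1 ^- 2).
have r1V : 0 < r1 ^- 2 by rewrite invr_gt0 exprn_gt0.
have C0 : 0 < C by rewrite mulr_gt0 //; lra.
(* The exponential lowers the value at [(x1, t1)] by [d / 4] only, so it still beats the bottom near
   [y0], where [u] varies by less than [d / 2]. *)
pose mu := d / 4; have mu0 : 0 < mu by rewrite divr_gt0.
pose k := (2 * M) / mu; have k0 : 0 < k by rewrite divr_gt0 // mulr_gt0.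
pose phi (p : E) := C * dot (z p) (z p) + mu * expR (k * (p.2 - t1)).
pose gx (p : E) : 'rV[R]_n := (C * 2) *: z p.
pose gt (p : E) := C * (- 2 * dot (z p) v) + mu * (expR (k * (p.2 - t1)) * k).
have phiC1 : C1_with_gradient phi gx gt.
  have quad := C1_gradient_sqr_dist (y0 - t0 *: v) v.
  have scale (c s : R) : is_derive s 1 ( *%R c) c.
    by apply: (is_derive_eq (is_deriveZ c (is_derive_id s 1))); rewrite /GRing.scale /= mulr1.
  have time : C1_with_gradient (fun p : E => k * (p.2 - t1)) (fun=> 0) (fun=> k).
    have lin : C1_with_gradient (fun p : E => k * p.2) (fun=> 0) (fun=> k).
      by apply: C1_gradient_linear => p; rewrite dot0l add0r.
    have := C1_gradientD lin (C1_gradient_cst (- (k * t1))).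
    rewrite !addr0 (_ : (fun p : E => _) = fun p => k * (p.2 - t1)) //.
    by apply/funext => p; rewrite mulrBr.
  have expt := C1_gradient_comp (@is_derive_expR R) (@continuous_expR R) time.
  have := C1_gradientD
    (C1_gradient_comp (scale C) (fun s => @cst_continuous _ _ C s) quad)
    (C1_gradient_comp (scale mu) (fun s => @cst_continuous _ _ mu s) expt).
  congr C1_with_gradient; apply/funext => p.
  by rewrite !scaler0 addr0 scalerA.
have cphi : continuous phi.
  by move=> p; apply: differentiable_continuous; case: phiC1 => h _ _; exact: ex_diff.
have [p pK pmax] := cylinder_max cu cphi KH (ex_intro _ _ Kxt).
have phi_ge q : C * dot (z q) (z q) <= phi q.
  by rewrite lerDl; apply: mulr_ge0; [exact: ltW|exact: expR_ge0].
have phi_ge' q : mu * expR (k * (q.2 - t1)) <= phi q.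
  by rewrite lerDr; apply: mulr_ge0; [exact: ltW|exact: dot_ge0].
have := pmax _ Kxt.
have -> : phi (x1, t1) = mu.
  rewrite /phi zE /= /v scalerA divff ?gt_eqF ?subr_gt0 // scale1r subrr.
  by rewrite dot0l mulr0 add0r subrr mulr0 expR0 mulr1.
move=> upmax.
have uyM := ler_normlW (uM _ Ky).
have upM := uM _ pK; have uyM' := uM _ Ky.
move: upM uyM'; rewrite !ler_norml => /andP[_ upM] /andP[uyM' _].
have low : - M < u p - phi p by rewrite (lt_le_trans _ upmax) // /mu; lra.
have zlt1 : C * dot (z p) (z p) < 2 * M by have := phi_ge p; lra.
have CM : 2 * M <= C by rewrite /C; nra.
have CM1 : 2 * M <= C * r1 ^+ 2.
  have -> : C * r1 ^+ 2 = (2 * M + 1) * (r1 ^+ 2 + 1).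
    by rewrite /C; field; rewrite gt_eqF.
  by have := sqr_ge0 r1; nra.
have p2t0 : t0 < p.2.
  rewrite lt_neqAle; have [_ /andP[-> _]] := pK; rewrite andbT; apply/negP => /eqP pt0.
  have zp : z p = p.1 - y0 by rewrite zE -pt0 subrr scale0r subr0.
  have [xr1|xr1] := ltP (enorm (p.1 - y0)) r1.
    have := r1P p (KH _ pK) xr1; rewrite -pt0 subrr normr0 => /(_ r10).
    rewrite ltr_norml => /andP[+ _].
    have : 0 <= phi p by rewrite (le_trans _ (phi_ge p)) //; apply: mulr_ge0; [exact: ltW|exact: dot_ge0].
    by move: upmax; rewrite /mu; lra.
  move: zlt1; apply/negP; rewrite -leNgt (le_trans CM1) // ler_pM2l // zp -enorm_sqr.
  by rewrite ler_pXn2r ?nnegrE ?enorm_ge0 // ltW.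
have p2t2 : p.2 < t2.
  rewrite lt_neqAle; have [_ /andP[_ ->]] := pK; rewrite andbT; apply/negP => /eqP pt2.
  have := phi_ge' p; rewrite pt2 /t2 addrC addKr mulr1.
  have := expR_ge1Dx k; have kmu : mu * k = 2 * M by rewrite /k mulrCA divff ?mulr1 ?gt_eqF.
  by nra.
have p1r : enorm (p.1 - y0) < r.
  rewrite lt_neqAle; have [-> _] := pK; rewrite andbT; apply/negP => /eqP p1r.
  have : 1 <= enorm (z p).
    rewrite zE (le_trans _ (enorm_dist_ge _ _)) // p1r enormZ ger0_norm; last by rewrite subr_ge0 ltW.
    have : (p.2 - t0) * enorm v <= (t2 - t0) * rho.
      by rewrite ler_pM ?enorm_ge0 ?subr_ge0 ?lerD2r // ltW.
    by rewrite /r; lra.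
  move=> z1; move: zlt1; apply/negP; rewrite -leNgt -enorm_sqr (le_trans CM) //.
  by rewrite ler_peMr ?exprn_ege1 // ltW.
have [C1phi tphi xphi] := C1_with_gradient_test phiC1.
have p20 : open_half p by rewrite /open_half /= (le_lt_trans t00).
have pnear : \forall q \near p, u q - phi q <= u p - phi p.
  apply: (filterS pmax); apply: cylinder_nbhs p1r _.
  by rewrite p2t0.
have := usub phi (C1phi _) p p20 pnear; rewrite tphi xphi.
rewrite /gt /gx enormZ ger0_norm; last by rewrite mulr_ge0 // ltW.
move=> H.
(* At an interior maximum, |v| <= rho <= beta makes the quadratic contribution nonnegative, and the
   exponential has positive time derivative: the subsolution inequality fails. *)
have := dot_le_enorm (z p) v; have := enorm_ge0 (z p); have := betage p.1.
have : 0 < mu * (expR (k * (p.2 - t1)) * k).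
  by apply: mulr_gt0 => //; apply: mulr_gt0 => //; exact: expR_gt0.
move: H; set e := mu * _; move=> H e0 br z0 dz.
have h1 : dot (z p) v <= enorm (z p) * rho by apply: (le_trans dz); rewrite ler_wpM2l.
have h2 : enorm (z p) * rho <= beta p.1 * enorm (z p) by rewrite mulrC ler_wpM2r.
have : 0 <= C * (beta p.1 * enorm (z p) - dot (z p) v).
  by apply: mulr_ge0; [exact: ltW|lra].
nra.
Qed.

End ConeMonotonicity.

(** * Testing the equation on the front *)

Section FrontTesting.
Context {R : realType} {n : nat}.
Local Notation E := ('rV[R]_n * R)%type.
Implicit Types (u psi : E -> R) (p q : E).

(** For large [k] this is huge where [s] is positive and never below [-1 / k]: a smooth increasing
    substitute for the function that is infinite for s > 0 and 0 for s <= 0. *)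
Definition steep (k s : R) : R := (expR (k ^+ 2 * s) - 1) / k.

Lemma steep_is_derive (k s : R) : k != 0 -> is_derive s 1 (steep k) (k * expR (k ^+ 2 * s)).
Proof.
move=> k0; rewrite /steep.
have lin : is_derive s 1 (fun r : R => k ^+ 2 * r) (k ^+ 2).
  by apply: (is_derive_eq (is_deriveZ (k ^+ 2) (is_derive_id s 1))); rewrite /GRing.scale /= mulr1.
have e := is_derive1_comp (is_derive_expR (k ^+ 2 * s)) lin.
have e1 := is_deriveB e (is_derive_cst (1 : R) s 1).
have e2 := is_deriveZ k^-1 e1.
have -> : (fun r : R => (expR (k ^+ 2 * r) - 1) / k) =
  k^-1 \*: ((expR \o (fun r => k ^+ 2 * r)) - cst 1).
  by apply/funext => r /=; rewrite mulrC.
by apply: (is_derive_eq e2); rewrite /GRing.scale /=; field.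
Qed.

Lemma C1_gradient_steep (k : R) psi gx gt : k != 0 ->
  C1_with_gradient psi gx gt ->
  C1_with_gradient (fun p => steep k (psi p))
    (fun p => (k * expR (k ^+ 2 * psi p)) *: gx p)
    (fun p => k * expR (k ^+ 2 * psi p) * gt p).
Proof.
move=> k0.
apply: (C1_gradient_comp (h := steep k) (h' := fun s => k * expR (k ^+ 2 * s))).
  by move=> s; exact: steep_is_derive.
move=> s; apply: (@continuousM _ _ (fun=> k) _ s); first exact: cst_continuous.
apply: (@continuous_comp _ _ _ ( *%R (k ^+ 2)) expR); last exact: continuous_expR.
exact: mulrl_continuous.
Qed.

(* Penalising by [steep k] with k large forces the maximum into the set where
   [u >= 0] and [psi <= 0], up to an arbitrarily small error. *)
Lemma steep_local_max (A : set E) u psi p0 r :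
  {within A, continuous u} -> continuous psi -> 0 < r ->
  cylinder p0.1 r (p0.2 - r) (p0.2 + r) `<=` A ->
  0 <= u p0 -> psi p0 = 0 ->
  (forall q, cylinder p0.1 r (p0.2 - r) (p0.2 + r) q ->
     0 <= u q -> psi q <= 0 -> q = p0) ->
  exists k q, [/\ 0 < k, enorm (q.1 - p0.1) < r, `|q.2 - p0.2| < r &
    \forall q' \near q, u q' - steep k (psi q') <= u q - steep k (psi q)].
Proof.
move=> cu cpsi r0 KA u0 psi0 touch.
set K := cylinder _ _ _ _ in KA touch.
have Kp0 : K p0 by split; rewrite ?subrr ?enorm0; lra.
pose m := (fun q : E => enorm (q.1 - p0.1)) \max (fun q : E => `|q.2 - p0.2|).
have cm : continuous m.
  move=> q; apply: continuous_max.
    apply: (@continuous_comp _ _ _ (fun q : E => q.1 - p0.1) (@enorm R n)).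
      exact: (cvgB (@cvg_fst _ _ _ (nbhs q.2) _) (@cvg_cst _ p0.1 _ (nbhs q) _)).
    exact: enorm_continuous.
  apply: cvg_norm.
  exact: (cvgB (@cvg_snd _ _ (nbhs q.1) _ _) (@cvg_cst _ p0.2 _ (nbhs q) _)).
(* [B] is the boundary of the cylinder. The touching hypothesis makes max(psi, -u) positive on it,
   hence bounded below by some [e > 0] by compactness. *)
pose B := [set q | r <= m q] `&` K.
have cK : compact K by exact: cylinder_compact.
have cB : compact B.
  rewrite /B setIC; apply: compact_closedI => //.
  by apply: (@closed_comp _ _ m [set s | r <= s]); [move=> q _; exact: cm|exact: closed_ge].
have BA : B `<=` A by move=> q [_ /KA].
have B0 : B !=set0.
  exists (p0.1, p0.2 + r); split=> /=.
    by rewrite /m /= le_max (addrC p0.2) addrK (gtr0_norm r0) lexx orbT.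
  by split=> /=; rewrite ?subrr ?enorm0; lra.
have [c Bc cmin] : exists2 c, c \in B &
    forall q, q \in B -> (psi \max (- u)) c <= (psi \max (- u)) q.
  apply: compact_EVT_min => // q; apply: continuous_max.
    exact: (continuous_subspaceT cpsi).
  apply: continuousN; exact: (continuous_subspaceW BA cu).
set e := (psi \max (- u)) c in cmin.
have e0 : 0 < e.
  rewrite ltNge /e /= ge_max; apply/negP => /andP[pc uc].
  rewrite inE in Bc; case: Bc => mc Kc.
  have cp : c = p0 by apply: touch => //; rewrite -oppr_le0.
  by move: mc; rewrite /= cp /m /= !subrr enorm0 normr0 maxxx leNgt r0.
have [M M0 uM] := cylinder_bounded cu KA.
(* On [B] either [psi >= e], and then the penalty is at least [k * e = M + 2], above the bound of
   [u], or [u <= - e], while the penalty never gains more than [1 / k < e]. Both contradict a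
   nonnegative maximum. *)
pose k := (M + 2) / e.
have k0 : 0 < k by rewrite divr_gt0 //; lra.
have ke : k * e = M + 2 by rewrite /k mulfVK ?gt_eqF.
have cpsik : continuous (fun q => steep k (psi q)).
  move=> q; rewrite /steep; apply: cvgM; last exact: cvg_cst.
  apply: cvgB; last exact: cvg_cst.
  apply: (@continuous_comp _ _ _ (fun q => k ^+ 2 * psi q) expR); last exact: continuous_expR.
  by apply: (@continuousM _ _ (fun=> k ^+ 2) _ q); [exact: cst_continuous|exact: cpsi].
have [q Kq qmax] := cylinder_max cu cpsik KA (ex_intro _ _ Kp0).
have wq : 0 <= u q - steep k (psi q).
  apply: le_trans (qmax _ Kp0).
  by rewrite psi0 /steep mulr0 expR0 subrr mul0r subr0.
have mq : m q < r.
  rewrite ltNge; apply/negP => rm.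
  have /cmin : q \in B by rewrite inE.
  rewrite /= fctE le_max => /orP[eq|eq].
    have h1 : M + 2 <= steep k (psi q).
      rewrite -ke /steep ler_pdivlMr // (le_trans (_ : _ <= k ^+ 2 * psi q)) //.
        by rewrite mulrAC -expr2 ler_pM2l ?exprn_gt0.
      by have := expR_ge1Dx (k ^+ 2 * psi q); lra.
    by have := ler_normlW (uM _ Kq); lra.
  have : - steep k (psi q) < e.
    rewrite /steep -mulNr ltr_pdivrMr // (mulrC e) ke.
    by have := expR_gt0 (k ^+ 2 * psi q); lra.
  lra.
move: mq; rewrite /m /= gt_max => /andP[q1 q2].
exists k, q; split=> //; apply: (filterS qmax); apply: cylinder_nbhs => //.
by move: q2; rewrite ltr_norml => /andP[? ?]; lra.
Qed.

(** The Hamiltonian is homogeneous of degree 1, so the positive factor from the chain rule through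
    [steep] divides out and an inequality for [psi] alone is left. *)
Lemma front_subsolution (beta : 'rV[R]_n -> R) u psi gx gt p0 r :
  {within closed_half, continuous u} -> viscosity_subsolution beta u ->
  C1_with_gradient psi gx gt -> 0 < r < p0.2 -> 0 <= u p0 -> psi p0 = 0 ->
  (forall q, cylinder p0.1 r (p0.2 - r) (p0.2 + r) q ->
     0 <= u q -> psi q <= 0 -> q = p0) ->
  exists q, [/\ enorm (q.1 - p0.1) < r, `|q.2 - p0.2| < r &
    gt q + beta q.1 * enorm (gx q) <= 0].
Proof.
move=> cu usub psiC1 /andP[r0 rp0] u0 psi0 touch.
have cpsi : continuous psi.
  by move=> p; apply: differentiable_continuous; case: psiC1 => h _ _; exact: ex_diff.
have [|k [q [k0 q1 q2 qmax]]] := steep_local_max cu cpsi r0 _ u0 psi0 touch.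
  by move=> q [_ /andP[q2 _]]; rewrite /closed_half /=; lra.
exists q; split=> //.
have [C1 st sx] := C1_with_gradient_test (C1_gradient_steep (lt0r_neq0 k0) psiC1).
have q0 : open_half q.
  by rewrite /open_half /=; move: q2; rewrite ltr_norml => /andP[? ?]; lra.
have := usub _ (C1 _) q q0 qmax; rewrite st sx.
have e0 : 0 < k * expR (k ^+ 2 * psi q) by rewrite mulr_gt0 ?expR_gt0.
by rewrite enormZ (gtr0_norm e0) mulrCA -mulrDr pmulr_rle0.
Qed.

(** The maximum principle of the steep penalty is applied to [- u] and [- psi]; the test function
    [- steep k (- psi)] again has a gradient that is a positive multiple of that of [psi]. *)
Lemma front_supersolution (beta : 'rV[R]_n -> R) u psi gx gt p0 r :
  {within closed_half, continuous u} -> viscosity_supersolution beta u ->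
  C1_with_gradient psi gx gt -> 0 < r < p0.2 -> u p0 <= 0 -> psi p0 = 0 ->
  (forall q, cylinder p0.1 r (p0.2 - r) (p0.2 + r) q ->
     u q <= 0 -> 0 <= psi q -> q = p0) ->
  exists q, [/\ enorm (q.1 - p0.1) < r, `|q.2 - p0.2| < r &
    0 <= gt q + beta q.1 * enorm (gx q)].
Proof.
move=> cu usup psiC1 /andP[r0 rp0] u0 psi0 touch.
have npsiC1 := C1_gradientN psiC1.
have cpsi : continuous (fun q => - psi q).
  by move=> p; apply: differentiable_continuous; case: npsiC1 => h _ _; exact: ex_diff.
have cnu : {within closed_half, continuous (fun q => - u q)}.
  by move=> q; apply: continuousN; exact: cu.
have [||||k [q [k0 q1 q2 qmax]]] :=
  @steep_local_max closed_half (fun q => - u q) (fun q => - psi q) p0 r cnu cpsi r0.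
- by move=> q [_ /andP[q2 _]]; rewrite /closed_half /=; lra.
- by rewrite oppr_ge0.
- by rewrite psi0 oppr0.
- by move=> q Kq; rewrite oppr_ge0 oppr_le0; exact: touch.
exists q; split=> //.
have stC1 := C1_gradient_steep (lt0r_neq0 k0) npsiC1.
have [C1 st sx] := C1_with_gradient_test (C1_gradientN stC1).
have q0 : open_half q.
  by rewrite /open_half /=; move: q2; rewrite ltr_norml => /andP[? ?]; lra.
have qmin : \forall q' \near q,
    u q - - steep k (- psi q) <= u q' - - steep k (- psi q').
  by apply: filterS qmax => q' h; lra.
have := usup _ (C1 _) q q0 qmin; rewrite st sx.
have e0 : 0 < k * expR (k ^+ 2 * - psi q) by rewrite mulr_gt0 ?expR_gt0.
rewrite scalerN opprK mulrN opprK.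
by rewrite enormZ (gtr0_norm e0) mulrCA -mulrDr pmulr_rge0.
Qed.

End FrontTesting.

(** * Arrival times of the front and their eikonal inequalities *)

Section ArrivalTime.
Context {R : realType} {n : nat}.
Local Notation E := ('rV[R]_n * R)%type.

Definition cone_stable (rho : R) (A : set E) : Prop :=
  forall (x y : 'rV[R]_n) (s t : R), 0 <= s <= t -> enorm (x - y) <= rho * (t - s) ->
    A (y, s) -> A (x, t).

Definition arrival (A : set E) (x : 'rV[R]_n) : R :=
  inf [set t | 0 <= t /\ A (x, t)].

Section ConeStable.
Context {rho : R} {A : set E} {y0 : 'rV[R]_n} {s0 : R}.
Hypotheses (rho0 : 0 < rho) (Acone : cone_stable rho A) (s00 : 0 <= s0) (Ay0 : A (y0, s0)).

(** The cone above one point of [A] reaches every [x], after the delay |x - y0| / rho; so the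
    default value of [inf] on the empty set never occurs. *)
Lemma arrival_has_inf x : has_inf [set t | 0 <= t /\ A (x, t)].
Proof.
split; last by exists 0 => t [].
have d0 : 0 <= enorm (x - y0) / rho by rewrite divr_ge0 ?enorm_ge0 ?ltW.
exists (s0 + enorm (x - y0) / rho); split; first by rewrite addr_ge0.
apply: Acone Ay0; first by rewrite s00 lerDl.
by rewrite addrAC subrr add0r mulrCA divff ?mulr1 ?gt_eqF.
Qed.

Lemma arrival_ge0 x : 0 <= arrival A x.
Proof. by apply: lb_le_inf => [|t []//]; have [] := arrival_has_inf x. Qed.

Lemma arrival_le x t : 0 <= t -> A (x, t) -> arrival A x <= t.
Proof. by move=> t0 At; apply: ge_inf => //; exists 0 => s []. Qed.

Lemma arrival_lt x t : arrival A x < t -> A (x, t).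
Proof.
have [ne _] := arrival_has_inf x.
move=> /(inf_lt ne)[s [s0' As] st].
apply: Acone As; first by rewrite s0' ltW.
by rewrite subrr enorm0 mulr_ge0 ?subr_ge0 ?ltW.
Qed.

Lemma arrival_lipschitz x y : rho * (arrival A x - arrival A y) <= enorm (x - y).
Proof.
rewrite leNgt; apply/negP => h.
have d0 : 0 <= enorm (x - y) / rho by rewrite divr_ge0 ?enorm_ge0 ?ltW.
have h' : arrival A y < arrival A x - enorm (x - y) / rho.
  by rewrite ltrBrDr -ltrBrDl ltr_pdivrMr // mulrC.
have [t /andP[yt tx]] : exists t, arrival A y < t < arrival A x - enorm (x - y) / rho.
  by exists ((arrival A y + (arrival A x - enorm (x - y) / rho)) / 2); lra.
have t0 : 0 <= t by rewrite (le_trans (arrival_ge0 y)) // ltW.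
suff : arrival A x <= t + enorm (x - y) / rho by move: tx; lra.
apply: arrival_le; first by rewrite addr_ge0.
apply: Acone (arrival_lt yt); first by rewrite t0 lerDl.
by rewrite addrAC subrr add0r mulrCA divff ?mulr1 ?gt_eqF.
Qed.

End ConeStable.

Context {rho : R} {u : E -> R} {y0 : 'rV[R]_n}.
Hypotheses (rho0 : 0 < rho) (cu : {within closed_half, continuous u}).
Hypothesis ucone : forall (x y : 'rV[R]_n) (s t : R),
  0 <= s <= t -> enorm (x - y) <= rho * (t - s) -> u (x, t) <= u (y, s).
Hypothesis uy0 : u (y0, 0) < 0.

(** These are S and T of the overview. Where S is positive, [u (x, t)] vanishes exactly for t
    between T and S, endpoints included. *)
Definition last_arrival : 'rV[R]_n -> R := arrival [set p | u p < 0].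
Definition first_arrival : 'rV[R]_n -> R := arrival [set p | u p <= 0].

Lemma neg_cone_stable : cone_stable rho [set p | u p < 0].
Proof. by move=> x y s t st xy /=; apply: le_lt_trans; exact: ucone. Qed.

Lemma nonpos_cone_stable : cone_stable rho [set p | u p <= 0].
Proof. by move=> x y s t st xy /=; apply: le_trans; exact: ucone. Qed.

Let uy0' : u (y0, 0) <= 0. Proof. exact: ltW. Qed.

Lemma last_arrival_ge0 x : 0 <= last_arrival x.
Proof. exact: (arrival_ge0 rho0 neg_cone_stable (lexx 0) uy0). Qed.

Lemma first_arrival_ge0 x : 0 <= first_arrival x.
Proof. exact: (arrival_ge0 rho0 nonpos_cone_stable (lexx 0) uy0'). Qed.

Lemma last_arrival_lipschitz x y :
  rho * (last_arrival x - last_arrival y) <= enorm (x - y).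
Proof. exact: (arrival_lipschitz rho0 neg_cone_stable (lexx 0) uy0). Qed.

Lemma first_arrival_lipschitz x y :
  rho * (first_arrival x - first_arrival y) <= enorm (x - y).
Proof. exact: (arrival_lipschitz rho0 nonpos_cone_stable (lexx 0) uy0'). Qed.

Lemma last_arrival_lt x t : last_arrival x < t -> u (x, t) < 0.
Proof. exact: (arrival_lt rho0 neg_cone_stable (lexx 0) uy0). Qed.

Lemma first_arrival_gt x t : 0 <= t < first_arrival x -> 0 < u (x, t).
Proof.
move=> /andP[t0 tx]; rewrite ltNge; apply/negP.
move=> /(@arrival_le [set p | u p <= 0] x t t0).
by rewrite leNgt; move/negP.
Qed.

Lemma le_last_arrival x t : 0 <= u (x, t) -> t <= last_arrival x.
Proof. by move=> u0; rewrite leNgt; apply/negP => /last_arrival_lt; rewrite ltNge u0. Qed.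

Lemma first_arrival_le x t : 0 <= t -> u (x, t) <= 0 -> first_arrival x <= t.
Proof. exact: (@arrival_le [set p | u p <= 0]). Qed.

(** If [u] were negative at this time, continuity would make it negative slightly earlier.
    Positivity leaves room for an earlier time: at time 0 the value may well be negative. *)
Lemma last_arrival_value x : 0 < last_arrival x -> 0 <= u (x, last_arrival x).
Proof.
move=> S0; rewrite leNgt; apply/negP => uS.
have SH : closed_half (x, last_arrival x) by rewrite /closed_half /= ltW.
have nu : 0 < - u (x, last_arrival x) by rewrite oppr_gt0.
have [r r0 rP] := within_continuous_enorm cu SH nu.
pose d := Order.min (r / 2) (last_arrival x / 2).
have d0 : 0 < d by rewrite lt_min !divr_gt0.
have dr : d <= r / 2 by rewrite ge_min lexx.
have dS : d <= last_arrival x / 2 by rewrite ge_min lexx orbT.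
have t0 : 0 <= last_arrival x - d by lra.
have := rP (x, last_arrival x - d) t0; rewrite /= subrr enorm0 => /(_ r0).
have -> : last_arrival x - d - last_arrival x = - d by lra.
rewrite normrN gtr0_norm // => /(_ ltac:(lra)); rewrite ltr_norml => /andP[h _].
have : u (x, last_arrival x - d) < 0 by lra.
by move=> /(@arrival_le [set p | u p < 0] x _ t0); rewrite -/(last_arrival x); lra.
Qed.

Lemma first_arrival_value x : u (x, first_arrival x) <= 0.
Proof.
rewrite leNgt; apply/negP => uT.
have TH : closed_half (x, first_arrival x) by exact: first_arrival_ge0.
have [r r0 rP] := within_continuous_enorm cu TH uT.
have T0 := first_arrival_ge0 x.
have t0 : 0 <= first_arrival x + r / 2 by lra.
have := rP (x, first_arrival x + r / 2) t0; rewrite /= subrr enorm0 => /(_ r0).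
rewrite (addrC _ (r / 2)) addrK gtr0_norm ?divr_gt0 // => /(_ ltac:(lra)).
rewrite ltr_norml => /andP[_ h].
have := arrival_lt rho0 nonpos_cone_stable (lexx 0) uy0'
  (_ : first_arrival x < r / 2 + first_arrival x).
by rewrite /= => /(_ ltac:(lra)); lra.
Qed.

(** With [w = 1 - exp(-S x0)], the zero set is the graph of the time t whose exp(-t) is exp(-S x0)
    minus a quadratic polynomial in [x - x0]; the time derivative -exp(-t) yields the zeroth order
    term. *)
Let front_test (w a : R) (b x0 : 'rV[R]_n) (p : E) : R :=
  w + dot b (p.1 - x0) + a * dot (p.1 - x0) (p.1 - x0) - 1 + expR (- p.2).

Let front_test_C1 w a b x0 :
  C1_with_gradient (front_test w a b x0)
    (fun p => b + (2 * a) *: (p.1 - x0)) (fun p => - expR (- p.2)).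
Proof.
have scale (c s : R) : is_derive s 1 ( *%R c) c.
  by apply: (is_derive_eq (is_deriveZ c (is_derive_id s 1))); rewrite /GRing.scale /= mulr1.
have quad := C1_gradient_comp (scale a) (fun s => @cst_continuous _ _ a s)
  (C1_gradient_sqr_dist x0 0).
have lin : C1_with_gradient (fun p : E => dot b p.1 + 0 * p.2) (fun=> b) (fun=> 0).
  exact: C1_gradient_linear.
have tim : C1_with_gradient (fun p : E => - p.2) (fun=> 0) (fun=> -1).
  by apply: C1_gradient_linear => p; rewrite dot0l add0r mulN1r.
have ex := C1_gradient_comp (@is_derive_expR R) (@continuous_expR R) tim.
have := C1_gradientD (C1_gradientD (C1_gradientD lin (C1_gradient_cst (w - dot b x0 - 1))) quad) ex.
congr C1_with_gradient; apply/funext => p.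
- by rewrite /front_test scaler0 subr0 !dotE mul0r; ring.
- by rewrite !scaler0 subr0 !addr0 scalerA (mulrC a).
- by rewrite dot0r mulr0 mulr0 !addr0 mulrN1 add0r.
Qed.

Let small_radius (a r r0 t0 : R) : 0 < r -> 0 < r0 -> 0 < t0 ->
  exists s, [/\ 0 < s < t0, s <= r, s <= r0 & `|2 * a| * s <= r].
Proof.
move=> rp r0p t0p.
exists (Order.min (r / (`|2 * a| + 1)) (Order.min r0 (t0 / 2))).
have a1 : 0 < `|2 * a| + 1 by rewrite ltr_wpDl.
split.
- by rewrite lt_min !divr_gt0 // lt_min r0p divr_gt0 //= !gt_min; apply/orP; right;
    apply/orP; right; lra.
- by rewrite ge_min ler_pdivrMr // mulrDr mulr1 lerDr mulr_ge0 // ltW.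
- by rewrite !ge_min lexx orbT.
- apply: (@le_trans _ _ (`|2 * a| * (r / (`|2 * a| + 1)))).
    by rewrite ler_wpM2l // ge_min lexx.
  rewrite mulrA ler_pdivrMr // mulrC ler_pM2l //; lra.
Qed.

Lemma last_arrival_subsolution (beta : 'rV[R]_n -> R) x0 b a r0 r :
  viscosity_subsolution beta u -> 0 < last_arrival x0 -> 0 < r0 -> 0 < r ->
  (forall x, enorm (x - x0) <= r0 ->
    expR (- last_arrival x0) - expR (- last_arrival x) <=
    dot b (x - x0) + a * dot (x - x0) (x - x0)) ->
  exists x t b', [/\ enorm (x - x0) < r, `|t - last_arrival x0| < r,
    enorm (b' - b) <= r & beta x * enorm b' <= expR (- t)].
Proof.
move=> usub S0 r0p rp above.
(* [a + 1] makes the contact strict: where [0 <= u] one has [t <= S x], so the test is at least |x -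
   x0|^2 and can be nonpositive only over [x0]. The last bound on [s] controls the change of the
   gradient. *)
have [s [/andP[sp sS] sr sr0 sa]] := small_radius (a + 1) rp r0p S0.
set p0 : E := (x0, last_arrival x0).
have [||||q [q1 q2 q3]] := @front_subsolution _ _ beta u _ _ _ p0 s cu usub
  (front_test_C1 (1 - expR (- last_arrival x0)) (a + 1) b x0).
- by rewrite sp.
- exact: last_arrival_value.
- by rewrite /front_test /= subrr !dotE; ring.
- move=> [x t] [/= xs /andP[ts1 ts2]] uq.
  have tS := le_last_arrival uq; have := above x (le_trans xs sr0).
  have eS : expR (- last_arrival x) <= expR (- t) by rewrite ler_expR lerN2.
  rewrite /front_test /= => ab psi0.
  have /eqP : dot (x - x0) (x - x0) = 0 by apply/le_anti; rewrite dot_ge0 andbT; lra.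
  rewrite -enorm_sqr sqrf_eq0 => /eqP /enorm_eq0 /eqP; rewrite subr_eq0 => /eqP xx0.
  move: psi0; rewrite xx0 subrr !dotE mulr0 !addr0 => h.
  have : expR (- t) <= expR (- last_arrival x0) by lra.
  rewrite ler_expR lerN2 => St; rewrite /p0; congr (_, _).
  by apply/le_anti; rewrite St -xx0 tS.
exists q.1, q.2, (b + (2 * (a + 1)) *: (q.1 - x0)); split.
- exact: lt_le_trans sr.
- exact: lt_le_trans sr.
- rewrite addrAC subrr add0r enormZ (le_trans _ sa) // ler_wpM2l // ltW //.
- by rewrite addrC subr_le0 in q3.
Qed.

Lemma first_arrival_supersolution (beta : 'rV[R]_n -> R) x0 b a r0 r :
  viscosity_supersolution beta u -> 0 < first_arrival x0 -> 0 < r0 -> 0 < r ->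
  (forall x, enorm (x - x0) <= r0 ->
    dot b (x - x0) + a * dot (x - x0) (x - x0) <=
    expR (- first_arrival x0) - expR (- first_arrival x)) ->
  exists x t b', [/\ enorm (x - x0) < r, `|t - first_arrival x0| < r,
    enorm (b' - b) <= r & expR (- t) <= beta x * enorm b'].
Proof.
move=> usup T0 r0p rp below.
(* Contact from the other side is made strict by [a - 1]: where [u <= 0], the test is at most - |x -
   x0|^2. *)
have [s [/andP[sp sS] sr sr0 sa]] := small_radius (a - 1) rp r0p T0.
set p0 : E := (x0, first_arrival x0).
have [||||q [q1 q2 q3]] := @front_supersolution _ _ beta u _ _ _ p0 s cu usup
  (front_test_C1 (1 - expR (- first_arrival x0)) (a - 1) b x0).
- by rewrite sp.
- exact: first_arrival_value.
- by rewrite /front_test /= subrr !dotE; ring.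
- move=> [x t] [/= xs /andP[ts1 ts2]] uq.
  have t0 : 0 <= t by lra.
  have tT := first_arrival_le t0 uq; have := below x (le_trans xs sr0).
  have eT : expR (- t) <= expR (- first_arrival x) by rewrite ler_expR lerN2.
  rewrite /front_test /= => be psi0.
  have /eqP : dot (x - x0) (x - x0) = 0 by apply/le_anti; rewrite dot_ge0 andbT; lra.
  rewrite -enorm_sqr sqrf_eq0 => /eqP /enorm_eq0 /eqP; rewrite subr_eq0 => /eqP xx0.
  move: psi0; rewrite xx0 subrr !dotE mulr0 !addr0 => h.
  have : expR (- first_arrival x0) <= expR (- t) by lra.
  rewrite ler_expR lerN2 => Tt; rewrite /p0; congr (_, _).
  by apply/le_anti; rewrite Tt -xx0 tT.
exists q.1, q.2, (b + (2 * (a - 1)) *: (q.1 - x0)); split.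
- exact: lt_le_trans sr.
- exact: lt_le_trans sr.
- rewrite addrAC subrr add0r enormZ (le_trans _ sa) // ler_wpM2l // ltW //.
- by rewrite addrC subr_ge0 in q3.
Qed.

End ArrivalTime.

Arguments last_arrival {R n} u x.
Arguments first_arrival {R n} u x.

(** * Bounds on the semicontinuous envelopes; local Lipschitz continuity in [enorm] *)

Section Envelopes.
Context {R : realType} {n : nat}.
Implicit Types (f : 'rV[R]_n -> R) (x y : 'rV[R]_n).

Lemma norm_le_enorm x : `|x| <= enorm x.
Proof.
rewrite [leLHS]/Num.norm /= mx_normrE; apply/bigmax_leP.
by split=> [|ij _]; [exact: enorm_ge0|rewrite (ord1 ij.1) coord_le_enorm].
Qed.

(** [fine] sends infinite values to 0, so a bound passes through it only once the value is known to
    be finite. For the envelopes, the bound on the other side is the value of the function at the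
    point. *)
Lemma fine_between (c d : R) (z : \bar R) :
  (c%:E <= z)%E -> (z <= d%:E)%E -> c <= fine z <= d.
Proof. by case: z => [r||] //=; rewrite !lee_fin => -> ->. Qed.

Lemma lsc_envelope_ge f x c :
  (\forall y \near x, c <= f y) -> c <= lsc_envelope f x.
Proof.
move=> fc; rewrite /lsc_envelope limf_einfE.
suff /andP[] : c <= fine (ereal_sup [set ereal_inf ((EFin \o f) @` V) | V in nbhs x]) <= f x by [].
apply: (@fine_between c (f x)).
  apply: (@le_trans _ _ (ereal_inf ((EFin \o f) @` [set y | c <= f y]))).
    by apply: le_ereal_inf_tmp => _ [y /= cy <-]; rewrite lee_fin.
  by apply: ereal_sup_ubound; exists [set y | c <= f y].
apply: ge_ereal_sup => _ [V xV <-]; apply: ereal_inf_lbound.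
by exists x => //; exact: nbhs_singleton.
Qed.

Lemma usc_envelope_le f x c :
  (\forall y \near x, f y <= c) -> usc_envelope f x <= c.
Proof.
move=> fc; rewrite /usc_envelope limf_esupE.
suff /andP[] : f x <= fine (ereal_inf [set ereal_sup ((EFin \o f) @` V) | V in nbhs x]) <= c by [].
apply: (@fine_between (f x) c); last first.
  apply: (@le_trans _ _ (ereal_sup ((EFin \o f) @` [set y | f y <= c]))); last first.
    by apply: ge_ereal_sup => _ [y /= cy <-]; rewrite lee_fin.
  by apply: ereal_inf_lbound; exists [set y | f y <= c].
apply: le_ereal_inf_tmp => _ [V xV <-]; apply: ereal_sup_ubound.
by exists x => //; exact: nbhs_singleton.
Qed.

Lemma lipschitz_on_enorm f (F : set_system ('rV[R]_n * 'rV[R]_n)) :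
  Filter F -> lipschitz_on f F ->
  exists2 M, 0 < M & F [set z | `|f z.1 - f z.2| <= M * enorm (z.1 - z.2)].
Proof.
move=> FF [M [_ MP]]; exists (`|M| + 1); first by rewrite ltr_wpDl.
have := MP (`|M| + 1); rewrite ltr_pwDr ?ler_norm // => /(_ isT).
rewrite /dominated_by; apply: (@filterS _ F FF) => z /= h.
by apply: (le_trans h); rewrite ler_wpM2l ?addr_ge0 // norm_le_enorm.
Qed.

Lemma locally_lipschitz_enorm f x : [locally [lipschitz f y | y in setT]] ->
  exists M r, [/\ 0 < M, 0 < r & forall y z, enorm (y - x) < r -> enorm (z - x) < r ->
    `|f y - f z| <= M * enorm (y - z)].
Proof.
move=> lf.
have [M M0 MP] := lipschitz_on_enorm (within_filter _ (nbhs_filter (x, x))) (lf (x, x) (conj I I)).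
case: MP => -[U V] [xU xV] UV.
have /nbhs_enormP[r r0 rU] : nbhs x U := xU.
have /nbhs_enormP[s s0 sV] : nbhs x V := xV.
exists M, (Order.min r s); split; rewrite ?lt_min ?r0 ?s0 //.
move=> y z; rewrite !lt_min => /andP[yr _] /andP[_ zs].
by apply: (UV (y, z)) => //; split; [exact: rU|exact: sV].
Qed.

Lemma locally_lipschitz_continuous f :
  [locally [lipschitz f y | y in setT]] -> continuous f.
Proof.
move=> lf x; have [M [r [M0 r0 fM]]] := locally_lipschitz_enorm x lf.
move=> A /nbhs_ballP[e /= e0 eA]; apply/nbhs_enormP.
exists (Order.min r (e / M)); first by rewrite lt_min r0 divr_gt0.
move=> y; rewrite lt_min => /andP[yr]; rewrite ltr_pdivlMr // mulrC => ye.
by apply: eA; apply: le_lt_trans ye; rewrite enormC; apply: fM => //; rewrite subrr enorm0.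
Qed.

End Envelopes.

(** * Projections and the sides of an open set *)

Section Interface.
Context {R : realType} {n : nat}.
Implicit Types (G Om : set 'rV[R]_n) (x y e : 'rV[R]_n).

Lemma proj_perpD e x y : proj_perp e (x + y) = proj_perp e x + proj_perp e y.
Proof. by rewrite /proj_perp dotDl; apply/rowP => i; rewrite !mxE; ring. Qed.

Lemma proj_perpZ e (a : R) x : proj_perp e (a *: x) = a *: proj_perp e x.
Proof. by rewrite /proj_perp dotZl; apply/rowP => i; rewrite !mxE; ring. Qed.

Lemma proj_perpN e x : proj_perp e (- x) = - proj_perp e x.
Proof. by rewrite -scaleN1r proj_perpZ scaleN1r. Qed.

(** A graph of [g] in direction [e] is therefore a graph of [- g] in direction [- e], which
    exchanges above and below. *)
Lemma proj_perpNl e x : proj_perp (- e) x = proj_perp e x.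
Proof. by rewrite /proj_perp dotNr scaleNr scalerN opprK. Qed.

Lemma proj_perp_id e : enorm e = 1 -> proj_perp e e = 0.
Proof. by move=> e1; rewrite /proj_perp -enorm_sqr e1 expr1n scale1r subrr. Qed.

Lemma enorm_proj_perp e x : enorm e = 1 -> enorm (proj_perp e x) <= 2 * enorm x.
Proof.
move=> e1; apply: (le_trans (enorm_triangleB _ _)); rewrite enormZ e1 mulr1.
suff : `|dot x e| <= enorm x by lra.
have h1 := dot_le_enorm x e; have h2 := dot_le_enorm (- x) e.
by move: h1 h2; rewrite enormN dotNl !e1 !mulr1 ler_norml; lra.
Qed.

(** Along a segment avoiding the boundary, the preimages of [Om] and of its closure coincide; this
    set is open, closed and nonempty in [0, 1], hence everything. *)
Lemma segment_one_side Om x y : open Om ->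
  (forall s : R, 0 <= s <= 1 -> ~ boundary Om (x + s *: (y - x))) ->
  Om x -> Om y.
Proof.
move=> oOm nG Omx.
pose g (s : R) := x + s *: (y - x).
have cg : continuous g.
  move=> s; apply: cvgD; first exact: cvg_cst.
  by apply: cvgZr_tmp; exact: cvg_id.
have conn := @segment_connected R 0 1.
have E : [set` `[0, 1]] `&` g @^-1` Om = [set` `[0, 1]]; [apply: conn|].
- by exists 0; split; rewrite /= ?in_itv /= ?lexx ?ler01 // /g scale0r addr0.
- exists (g @^-1` Om) => //; apply: open_comp => // s _; exact: cg.
- exists (g @^-1` closure Om).
    by apply: closed_comp; [move=> s _; exact: cg|exact: closed_closure].
  apply/seteqP; split=> s [s01 sO]; split=> //; first exact: subset_closure.
  rewrite /= in_itv /= in s01; apply: contrapT => nOs; apply: (nG s s01).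
  by split=> // /interior_subset.
have : [set` `[0, 1]] (1 : R) by rewrite /= in_itv /= ler01 lexx.
by rewrite -E => -[_]; rewrite /g /= scale1r addrC subrK.
Qed.

End Interface.

(** * Transversal crossing of the interface *)

Section LocalStructure.
Context {R : realType} {n : nat}.
Implicit Types (G Om : set 'rV[R]_n) (x y e : 'rV[R]_n) (g : 'rV[R]_n -> R).

Definition graph_near G x0 (r : R) e g : Prop :=
  forall y, enorm (y - x0) < r -> (G y <-> dot y e = g (proj_perp e y)).

Definition enorm_lipschitz (L : R) g : Prop :=
  forall a b, `|g a - g b| <= L * enorm (a - b).

Lemma nbhs_enorm_ball x (r : R) : 0 < r -> nbhs x [set z | enorm (z - x) < r].
Proof. by move=> r0; apply/nbhs_enormP; exists r. Qed.

(* The part of a small ball above the graph is joined to one point far above the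
   centre by segments which do not meet the graph. *)
Lemma above_graph_same_side Om x0 (r1 L : R) e g p q :
  open Om -> 0 < r1 -> 0 < L -> enorm e = 1 -> enorm_lipschitz L g ->
  graph_near (boundary Om) x0 r1 e g ->
  enorm (p - x0) < r1 / (4 + 4 * L) -> enorm (q - x0) < r1 / (4 + 4 * L) ->
  g (proj_perp e p) < dot p e -> g (proj_perp e q) < dot q e ->
  Om p -> Om q.
Proof.
move=> oOm r10 L0 e1 gL graph px qx hp hq.
set r := r1 / (4 + 4 * L) in px qx.
have r0 : 0 < r by rewrite divr_gt0 //; lra.
(* From [z] towards [c] the height grows by at least [s * (H - r)], and [g] by at most
   [2 * L * s * r], which is less. The radius [r] is such that [H = r1 / 2], so the segments stay
   where the boundary is a graph. *)
pose H := (2 + 2 * L) * r.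
have Hr1 : H = r1 / 2 by rewrite /H /r; field; apply/eqP; lra.
have H0 : 0 < H by rewrite Hr1 divr_gt0.
have rH : r <= H by rewrite /H ler_peMl ?ltW //; lra.
pose c := x0 + H *: e.
have above z s : enorm (z - x0) < r -> g (proj_perp e z) < dot z e -> 0 <= s <= 1 ->
    ~ boundary Om (z + s *: (c - z)).
  move=> zx hz /andP[s0 s1].
  set w := z + _.
  have wE : w - x0 = (1 - s) *: (z - x0) + (s * H) *: e.
    by apply/rowP => i; rewrite /w /c !mxE; ring.
  have wx : enorm (w - x0) < r1.
    rewrite wE; apply: le_lt_trans (enorm_triangle _ _) _.
    have sH : 0 <= s * H by rewrite mulr_ge0 // ltW.
    rewrite !enormZ e1 mulr1 (ger0_norm sH) ger0_norm ?subr_ge0 //.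
    have h1 : (1 - s) * enorm (z - x0) <= (1 - s) * H.
      by rewrite ler_wpM2l ?subr_ge0 // (le_trans (ltW zx)).
    have h2 : (1 - s) * H + s * H = r1 / 2 by rewrite -Hr1; ring.
    lra.
  move=> /(graph w wx) => gw.
  have we : dot w e = dot z e + s * (H - dot (z - x0) e).
    by rewrite /w /c !dotE -enorm_sqr e1; ring.
  have Pw : proj_perp e w = proj_perp e z - s *: proj_perp e (z - x0).
    rewrite /w /c proj_perpD proj_perpZ !proj_perpD proj_perpZ proj_perp_id //.
    by rewrite !proj_perpN scaler0; apply/rowP => i; rewrite !mxE; ring.
  have := gL (proj_perp e w) (proj_perp e z).
  have -> : proj_perp e w - proj_perp e z = - (s *: proj_perp e (z - x0)).
    by rewrite Pw addrAC subrr add0r.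
  rewrite -gw we enormN enormZ (ger0_norm s0) ler_norml => /andP[_].
  have h1 := enorm_proj_perp (z - x0) e1.
  have h2 := dot_le_enorm (z - x0) e; rewrite e1 mulr1 in h2.
  have h3 : L * (s * enorm (proj_perp e (z - x0))) <= L * (s * (2 * r)).
    rewrite ler_pM2l // ler_wpM2l //; lra.
  have h4 : 0 <= s * (r - dot (z - x0) e) by rewrite mulr_ge0 //; lra.
  have h5 : 0 <= s * r by rewrite mulr_ge0 // ltW.
  by rewrite /H; nra.
move=> Op.
have Oc : Om c by apply: (segment_one_side oOm _ Op) => s s01; exact: above.
apply: (segment_one_side oOm _ Oc) => s /andP[s0 s1].
have -> : c + s *: (q - c) = q + (1 - s) *: (c - q).
  by apply/rowP => i; rewrite !mxE; ring.
by apply: above => //; apply/andP; split; lra.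
Qed.

Lemma boundary_open_disjoint Om x : open Om -> Om x -> ~ boundary Om x.
Proof. by move=> oOm Ox [_]; apply; exact: oOm. Qed.

Lemma orients_sides Om G x : orients Om G -> ~ G x -> Om x \/ (~` closure Om) x.
Proof.
move=> [oOm <- _] nG; case: (pselect (closure Om x)); last by right.
by left; apply: contrapT => nO; apply: nG; split=> // /interior_subset.
Qed.

(** A cone condition: [x - y] lies in a cone of opening [c0] around [eta]. The alternative names the
    two open sides, because only there are both envelopes of the velocity known. *)
Definition crosses_upward Om x0 (eta : 'rV[R]_n) (c0 r : R) : Prop :=
  forall x y (eps : R), 0 < eps -> enorm (x - x0) < r -> enorm (y - x0) < r ->
    enorm (x - y - eps *: eta) <= c0 * eps -> Om y \/ (~` closure Om) x.

(** One point of [Om] below the graph puts everything below it into [Om]. Since [G] is also the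
    boundary of the outer side, that side meets the ball as well, necessarily above the graph, and
    so fills the part above. *)
Lemma graph_crosses_upward Om G x0 (r1 L : R) e g y0 :
  orients Om G -> G x0 -> 0 < r1 -> 0 < L -> enorm e = 1 -> enorm_lipschitz L g ->
  graph_near G x0 r1 e g -> enorm (y0 - x0) < r1 / (4 + 4 * L) ->
  dot y0 e < g (proj_perp e y0) -> Om y0 ->
  exists c0 r, [/\ 0 < c0, 0 < r & crosses_upward Om x0 e c0 r].
Proof.
move=> orOm Gx0 r10 L0 e1 gL graph y0x hy0 Oy0.
have [oOm bO bW] := orOm.
set r := r1 / (4 + 4 * L) in y0x.
have r0 : 0 < r by rewrite divr_gt0 //; lra.
have rr1 : r <= r1.
  by rewrite ler_pdivrMr; [rewrite ler_peMr ?ltW //|]; lra.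
have oW : open (~` closure Om) by apply: closed_openC; exact: closed_closure.
have below p : enorm (p - x0) < r -> dot p e < g (proj_perp e p) -> Om p.
  move=> px hp; apply: (@above_graph_same_side Om x0 r1 L (- e) (fun a => - g a) y0 p) => //.
  - by rewrite enormN.
  - by move=> a b; rewrite -opprD normrN; exact: gL.
  - move=> y yx; rewrite bO (graph y yx) proj_perpNl dotNr.
    by split=> [->//|/oppr_inj].
  - by rewrite proj_perpNl dotNr ltrN2.
  - by rewrite proj_perpNl dotNr ltrN2.
have [z0 [z0x Wz0]] : exists z, enorm (z - x0) < r /\ (~` closure Om) z.
  have : boundary (~` closure Om) x0 by rewrite bW.
  move=> [/(_ _ (nbhs_enorm_ball x0 r0)) [z [Wz zx]] _]; by exists z.
have hz0 : g (proj_perp e z0) < dot z0 e.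
  rewrite lt_neqAle leNgt; apply/andP; split.
    apply/eqP => gz.
    have : G z0 by apply/(graph z0 (lt_le_trans z0x rr1)).
    by rewrite -bO => -[].
  by apply/negP => /(below _ z0x) /subset_closure.
have above p : enorm (p - x0) < r -> g (proj_perp e p) < dot p e -> (~` closure Om) p.
  move=> px hp; apply: (@above_graph_same_side _ x0 r1 L e g z0 p) => //.
  by rewrite bW.
have c00 : 0 < 2 + 4 * L by lra.
(* For an error [w] in the shift, the height rises by at least [eps - |w|] and [g] by at most
   [2 * L * |w|]; this opening gives [(1 + 2 * L) * |w| <= eps / 2], so [x] is strictly above the
   graph if [y] is not below it. *)
exists (2 + 4 * L)^-1, r; split; rewrite ?invr_gt0 // => x y eps eps0 xx yx xy.
have [hy|hy] := ltP (dot y e) (g (proj_perp e y)); first by left; exact: below.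
right; apply: above => //.
set w := x - y - eps *: e in xy.
have xE : x = y + eps *: e + w by apply/rowP => i; rewrite /w !mxE; ring.
have xe : dot x e = dot y e + eps + dot w e.
  by rewrite xE !dotE -enorm_sqr e1; ring.
have Px : proj_perp e x - proj_perp e y = proj_perp e w.
  rewrite xE !proj_perpD proj_perpZ proj_perp_id // scaler0 addr0.
  by apply/rowP => i; rewrite !mxE; ring.
have := gL (proj_perp e x) (proj_perp e y); rewrite Px ler_norml => /andP[_ gx].
have Pw := enorm_proj_perp w e1.
have := dot_le_enorm (- w) e; rewrite enormN dotNl e1 mulr1 => we.
have h1 : L * enorm (proj_perp e w) <= L * (2 * enorm w) by rewrite ler_pM2l.
have h2 : (1 + 2 * L) * enorm w <= eps / 2.
  have -> : eps / 2 = (1 + 2 * L) * ((2 + 4 * L)^-1 * eps).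
    by field; apply/eqP; lra.
  by rewrite ler_pM2l //; lra.
by rewrite xe; nra.
Qed.

(** Off [G] a whole ball lies on one side and [eta = 0] will do. On [G] the sign of [e] is chosen so
    that a nearby point of [Om] is below the graph; it cannot be on it, since [Om] is open. *)
Lemma interface_crosses_upward G Om x0 :
  oriented_closed_lipschitz_hypersurface G Om ->
  exists eta c0 r, [/\ 0 < c0, 0 < r & crosses_upward Om x0 eta c0 r].
Proof.
move=> [[_ lipG] clG _ orOm]; have [oOm bO bW] := orOm.
have [Gx0|nGx0] := pselect (G x0); last first.
  have oW : open (~` closure Om) by apply: closed_openC; exact: closed_closure.
  have [Ox|Wx] := orients_sides orOm nGx0.
    have /nbhs_enormP[r r0 rO] : nbhs x0 Om by exact: oOm.
    by exists 0, 1, r; split=> // x y eps _ _ yr _; left; exact: rO.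
  have /nbhs_enormP[r r0 rO] : nbhs x0 (~` closure Om) by exact: oW.
  by exists 0, 1, r; split=> // x y eps _ xr _ _; right; exact: rO.
have [e [g [e1 glip /nbhs_enormP[r1 r10 graph]]]] := lipG x0 Gx0.
have [L L0 gL'] := lipschitz_on_enorm _ glip.
have gL : enorm_lipschitz L g by move=> a b; exact: (gL' (a, b)).
set r := r1 / (4 + 4 * L).
have r0 : 0 < r by rewrite divr_gt0 //; lra.
have rr1 : r <= r1.
  by rewrite ler_pdivrMr; [rewrite ler_peMr ?ltW //|]; lra.
have [y0 [y0x Oy0]] : exists y, enorm (y - x0) < r /\ Om y.
  have : boundary Om x0 by rewrite bO.
  move=> [/(_ _ (nbhs_enorm_ball x0 r0)) [z [Oz zx]] _]; by exists z.
have [hy|hy|hy] := ltgtP (dot y0 e) (g (proj_perp e y0)).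
- have [c0 [s H]] := graph_crosses_upward orOm Gx0 r10 L0 e1 gL graph y0x hy Oy0.
  by exists e, c0, s.
- have [|||//|c0 [s H]] := @graph_crosses_upward Om G x0 r1 L (- e) (fun a => - g a) y0
    orOm Gx0 r10 L0 _ _ _ y0x _ Oy0.
  + by rewrite enormN.
  + by move=> a b; rewrite -opprD normrN; exact: gL.
  + move=> y yx; rewrite (graph y yx) proj_perpNl dotNr.
    by split=> [->//|/oppr_inj].
  + by rewrite proj_perpNl dotNr ltrN2.
  + by exists (- e), c0, s.
- have : G y0 by apply/(graph y0 (lt_le_trans y0x rr1)).
  by rewrite -bO => /(boundary_open_disjoint oOm Oy0).
Qed.

End LocalStructure.

(** * The envelopes of the piecewise Lipschitz velocity *)

Section VelocityEnvelopes.
Context {R : realType} {n : nat}.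
Context {rho : R} {G Om : set 'rV[R]_n} {n1 n2 alpha : 'rV[R]_n -> R}.
Hypothesis vel : piecewise_lipschitz_velocity rho G Om n1 n2 alpha.

Lemma dist_to_ge0 (A : set 'rV[R]_n) x : A !=set0 -> 0 <= dist_to A x.
Proof.
move=> [y Ay]; apply: lb_le_inf; first by exists (enorm (x - y)), y.
by move=> _ [z Az <-]; exact: enorm_ge0.
Qed.

Lemma dist_to_gt0 (A : set 'rV[R]_n) x : A !=set0 -> closed A -> ~ A x -> 0 < dist_to A x.
Proof.
move=> [y Ay] clA nAx.
have /nbhs_enormP[r r0 rA] : nbhs x (~` A) by have := closed_openC clA; exact.
apply: (lt_le_trans r0); apply: lb_le_inf; first by exists (enorm (x - y)), y.
move=> _ [z Az <-]; rewrite leNgt enormC; apply/negP => /rA; exact.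
Qed.

Lemma dist_to_eq0 (A : set 'rV[R]_n) x : A x -> dist_to A x = 0.
Proof.
move=> Ax; apply/le_anti; rewrite dist_to_ge0 ?andbT; last by exists x.
apply: ge_inf; first by exists 0 => _ [z Az <-]; exact: enorm_ge0.
by exists x; rewrite ?subrr ?enorm0.
Qed.

Let orOm : orients Om G := hyp_oriented (vel_hypersurface vel).
Let G0 : G !=set0. Proof. by have [[]] := vel_hypersurface vel. Qed.
Let clG : closed G := hyp_closed (vel_hypersurface vel).
Let oOm : open Om. Proof. by case: orOm. Qed.

Lemma velocity_neg x : Om x -> alpha x = n1 x.
Proof.
move=> Ox; apply: (vel_neg vel); rewrite /signed_dist mem_set // oppr_lt0.
apply: dist_to_gt0 => //; case: orOm => _ <- _; exact: boundary_open_disjoint.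
Qed.

Lemma velocity_pos x : (~` closure Om) x -> alpha x = n2 x.
Proof.
move=> Wx; apply: (vel_pos vel); rewrite /signed_dist memNset; last first.
  by move=> /subset_closure.
by apply: dist_to_gt0 => //; case: orOm => _ <- _ [].
Qed.

Lemma velocity_between x : n1 x <= alpha x <= n2 x.
Proof.
have n12 := vel_n1_lt_n2 vel x.
have [Gx|nGx] := pselect (G x).
  apply: (vel_zero vel); rewrite /signed_dist dist_to_eq0 // oppr0.
  by case: ifP.
have [/velocity_neg ->|/velocity_pos ->] := orients_sides orOm nGx.
  by rewrite lexx ltW.
by rewrite lexx ltW.
Qed.

Let n1_near x e : 0 < e -> \forall y \near x, n1 x - e <= n1 y <= n1 x + e.
Proof.
move=> e0; have cn := locally_lipschitz_continuous (vel_n1_lipschitz vel).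
have nb : nbhs x (n1 @^-1` ball (n1 x) e) by apply: cn; exact: nbhsx_ballx.
apply: (filterS _ nb) => y; rewrite /ball /= ltr_norml => /andP[? ?]; lra.
Qed.

Let n2_near x e : 0 < e -> \forall y \near x, n2 x - e <= n2 y <= n2 x + e.
Proof.
move=> e0; have cn := locally_lipschitz_continuous (vel_n2_lipschitz vel).
have nb : nbhs x (n2 @^-1` ball (n2 x) e) by apply: cn; exact: nbhsx_ballx.
apply: (filterS _ nb) => y; rewrite /ball /= ltr_norml => /andP[? ?]; lra.
Qed.

Lemma lsc_velocity_ge x : n1 x <= lsc_envelope alpha x.
Proof.
apply/ler_addgt0Pr => e e0; rewrite -lerBlDr; apply: lsc_envelope_ge.
apply: filterS (n1_near x e0) => y /andP[h _].
by have /andP[h' _] := velocity_between y; exact: le_trans h'.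
Qed.

Lemma usc_velocity_le x : usc_envelope alpha x <= n2 x.
Proof.
apply/ler_addgt0Pr => e e0; apply: usc_envelope_le.
apply: filterS (n2_near x e0) => y /andP[_ h].
by have /andP[_ h'] := velocity_between y; exact: le_trans h.
Qed.

Lemma usc_velocity_neg x : Om x -> usc_envelope alpha x <= n1 x.
Proof.
move=> Ox; apply/ler_addgt0Pr => e e0; apply: usc_envelope_le.
have nO : nbhs x Om by exact: oOm.
by apply: filterS2 nO (n1_near x e0) => y /velocity_neg -> /andP[].
Qed.

Lemma lsc_velocity_pos x : (~` closure Om) x -> n2 x <= lsc_envelope alpha x.
Proof.
move=> Wx; apply/ler_addgt0Pr => e e0; rewrite -lerBlDr; apply: lsc_envelope_ge.
have nW : nbhs x (~` closure Om).
  by have := closed_openC (@closed_closure _ Om); exact.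
by apply: filterS2 nW (n2_near x e0) => y /velocity_pos -> /andP[].
Qed.

Lemma lsc_velocity_ge_rho x : rho <= lsc_envelope alpha x.
Proof. exact: le_trans (vel_n1_ge vel x) (lsc_velocity_ge x). Qed.

Lemma usc_velocity_bounded : exists2 M, 0 < M & forall x, usc_envelope alpha x <= M.
Proof.
have [M [_ MP]] := vel_bounded vel.
exists (`|M| + 1); first by rewrite ltr_wpDl.
move=> x; apply: usc_envelope_le; apply/nbhs_enormP; exists 1 => // y _.
have := MP (`|M| + 1); rewrite ltr_pwDr ?ler_norm // => /(_ isT y I).
exact: le_trans (ler_norm _).
Qed.

(** Each alternative of the crossing compares the envelopes through a single locally Lipschitz
    function: [n1] if [y] is on the slow side, [n2] if [x] is on the fast side. *)
Lemma velocity_crosses_upward x0 : exists eta c0 r C, [/\ 0 < c0, 0 < r, 0 < C &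
  forall x y eps, 0 < eps -> enorm (x - x0) < r -> enorm (y - x0) < r ->
    enorm (x - y - eps *: eta) <= c0 * eps ->
    usc_envelope alpha y <= lsc_envelope alpha x + C * enorm (x - y)].
Proof.
have [eta [c0 [r [c00 r0 cross]]]] := interface_crosses_upward x0 (vel_hypersurface vel).
have [C1 [r1 [C10 r10 lip1]]] := locally_lipschitz_enorm x0 (vel_n1_lipschitz vel).
have [C2 [r2 [C20 r20 lip2]]] := locally_lipschitz_enorm x0 (vel_n2_lipschitz vel).
exists eta, c0, (Order.min r (Order.min r1 r2)), (C1 + C2); split=> //.
- by rewrite !lt_min r0 r10 r20.
- exact: addr_gt0.
move=> x y eps eps0; rewrite !lt_min => /and3P[xr xr1 xr2] /and3P[yr yr1 yr2] xy.
have h1 : 0 <= C1 * enorm (x - y) by rewrite mulr_ge0 ?enorm_ge0 ?ltW.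
have h2 : 0 <= C2 * enorm (x - y) by rewrite mulr_ge0 ?enorm_ge0 ?ltW.
have [Oy|Wx] := cross x y eps eps0 xr yr xy.
  have := usc_velocity_neg Oy; have := lsc_velocity_ge x.
  by have := lip1 x y xr1 yr1; rewrite ler_norml => /andP[? ?]; lra.
have := usc_velocity_le y; have := lsc_velocity_pos Wx.
by have := lip2 x y xr2 yr2; rewrite ler_norml => /andP[? ?]; lra.
Qed.

End VelocityEnvelopes.

(** * Localized maxima and doubling of variables *)

Section Doubling.
Context {R : realType} {n : nat}.
Implicit Types (x y z eta : 'rV[R]_n) (E F : 'rV[R]_n -> R).

Lemma enorm_lipschitz_continuous (L : R) E : 0 < L -> enorm_lipschitz L E -> continuous E.
Proof.
move=> L0 EL x A /nbhs_ballP[e /= e0 eA]; apply/nbhs_enormP.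
exists (e / L); first by rewrite divr_gt0.
move=> y; rewrite ltr_pdivlMr // mulrC => ye; apply: eA.
by apply: le_lt_trans ye; rewrite enormC; exact: EL.
Qed.

Lemma sqr_dist_expand x y z : dot (y - z) (y - z) - dot (x - z) (x - z) =
  dot (2 *: (x - z)) (y - x) + dot (y - x) (y - x).
Proof. by rewrite !dotE (dotC x y) (dotC z y) (dotC z x); ring. Qed.

Lemma dot_sqrB x y : dot (x - y) (x - y) = dot x x - 2 * dot x y + dot y y.
Proof. by rewrite !dotE (dotC y x); ring. Qed.

(** Beyond distance [s^-1] from [x1] the penalty is at least 1 and the value at most 0, below that
    at [x1]; so the maximum over a compact ball is global. *)
Lemma penalized_max E (s : R) x1 : continuous E -> (forall x, E x <= 1) ->
  0 < s -> 0 < E x1 ->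
  exists xh, [/\ E x1 <= E xh, s * enorm (xh - x1) <= 1 &
    forall x, E x - s ^+ 2 * dot (x - x1) (x - x1) <=
      E xh - s ^+ 2 * dot (xh - x1) (xh - x1)].
Proof.
move=> cE E1 s0 Ex1.
pose f x := E x - s ^+ 2 * dot (x - x1) (x - x1).
have cf : continuous f.
  move=> x; apply: (@continuousB R R^o _ E (fun x => s ^+ 2 * dot (x - x1) (x - x1)) x).
    exact: cE.
  apply: (@continuousM _ _ (fun=> s ^+ 2) (fun y => dot (y - x1) (y - x1)) x); first exact: cst_continuous.
  have sub : y - x1 @[y --> x] --> x - x1.
    exact: (cvgB (@cvg_id _ (nbhs x)) (@cvg_cst _ x1 _ (nbhs x) _)).
  exact: (cvg_dot sub sub).
have b0 : [set x | enorm (x - x1) <= s^-1] !=set0.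
  by exists x1; rewrite /= subrr enorm0 invr_ge0 ltW.
have [xh xhB xhmax] := compact_EVT_max b0 (@enorm_ball_compact _ _ x1 s^-1)
  (continuous_subspaceT cf).
rewrite inE /= in xhB.
have fx1 : f x1 = E x1 by rewrite /f subrr dot0l mulr0 subr0.
have fmax x : f x <= f xh.
  have [xB|xB] := leP (enorm (x - x1)) s^-1; first by apply: xhmax; rewrite inE.
  apply: (@le_trans _ _ (f x1)); last first.
    by apply: xhmax; rewrite inE /= subrr enorm0 invr_ge0 ltW.
  rewrite fx1 (le_trans _ (ltW Ex1)) // subr_le0 (le_trans (E1 x)) //.
  rewrite -enorm_sqr -exprMn exprn_ege1 //.
  by move: xB; rewrite -[s^-1]mul1r ltr_pdivrMr // mulrC => /ltW.
exists xh; split=> //.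
  have := fmax x1; rewrite fx1 /f => h; apply: (le_trans h).
  by rewrite gerBl mulr_ge0 ?sqr_ge0 ?dot_ge0.
by move: xhB; rewrite -[s^-1]mul1r ler_pdivlMr // mulrC.
Qed.

(* [E1] and [E2] stand for exp(-S) and exp(-T).  The shift by [eps *: eta] makes
   the first point lie upward of the second one. *)
Lemma doubling_point E1 E2 (L beta k0 sigma : R) x1 xh eta :
  0 < L -> 0 <= beta -> 0 < k0 -> 0 < sigma <= 4^-1 ->
  enorm_lipschitz L E1 -> enorm_lipschitz L E2 ->
  (forall x, E2 x - E1 x - beta * dot (x - x1) (x - x1) <=
     E2 xh - E1 xh - beta * dot (xh - x1) (xh - x1)) ->
  exists eps q x y,
   [/\ [/\ 0 < eps, 0 <= q & k0 * eps <= sigma],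
       [/\ enorm (x - xh) <= sigma, enorm (y - xh) <= 2 * sigma & enorm (x - y) <= sigma],
       enorm (x - y - eps *: eta) <= k0 * eps /\
       q * enorm (x - y - eps *: eta) <= 2 * L * (k0 + 2 * enorm eta) / k0,
       forall x', enorm (x' - x) <= 2^-1 -> E1 x - E1 x' <=
         dot ((2 * q) *: (x - y - eps *: eta) + (2 * beta) *: (x - x1) + 2 *: (x - xh)) (x' - x)
         + (q + beta + 1) * dot (x' - x) (x' - x) &
       forall y', enorm (y' - y) <= 2^-1 ->
         dot ((2 * q) *: (x - y - eps *: eta)) (y' - y) + (- q) * dot (y' - y) (y' - y)
           <= E2 y - E2 y'].
Proof.
move=> L0 be0 k00 /andP[s0 s4] E1L E2L xhmax.
set K := enorm eta.
have K0 : 0 <= K := enorm_ge0 eta.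
pose B := L * (k0 + 2 * K).
have B0 : 0 < B by rewrite mulr_gt0 //; lra.
(* With [q = D / eps], an offset of size [k0 * eps] costs [2 * B * eps], twice what the Lipschitz
   bounds can gain, while the slope [q * k0 * eps = 2 * B / k0] does not depend on [eps]. The two
   bounds on [eps] bring [x] close to [xh] and [y] close to [x]. *)
pose D := 2 * B / k0 ^+ 2.
have D0 : 0 < D by rewrite divr_gt0 ?exprn_gt0 //; lra.
pose eps := Order.min (sigma ^+ 2 / B) (sigma / (k0 + K)).
have k0K : 0 < k0 + K by lra.
have eps0 : 0 < eps by rewrite lt_min !divr_gt0 ?exprn_gt0.
have epsB : B * eps <= sigma ^+ 2.
  by rewrite mulrC -ler_pdivlMr // ge_min lexx.
have epsK : (k0 + K) * eps <= sigma.
  by rewrite mulrC -ler_pdivlMr // ge_min lexx orbT.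
pose q := D / eps.
have q0 : 0 < q by rewrite divr_gt0.
pose z (p : 'rV[R]_n * 'rV[R]_n) := p.1 - p.2 - eps *: eta.
pose Phi (p : 'rV[R]_n * 'rV[R]_n) := E2 p.2 - E1 p.1
  - beta * dot (p.1 - x1) (p.1 - x1) - dot (p.1 - xh) (p.1 - xh) - q * dot (z p) (z p).
have cB (f h : 'rV[R]_n * 'rV[R]_n -> R) : continuous f -> continuous h ->
    continuous (fun p => f p - h p).
  by move=> cf ch p; exact: (@continuousB R R^o _ f h p (cf p) (ch p)).
have cBv (f h : 'rV[R]_n * 'rV[R]_n -> 'rV[R]_n) : continuous f -> continuous h ->
    continuous (fun p => f p - h p).
  by move=> cf ch p; exact: (continuousB (cf p) (ch p)).
have cN (f : 'rV[R]_n * 'rV[R]_n -> 'rV[R]_n) : continuous f ->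
    continuous (fun p => dot (f p) (f p)).
  by move=> cf p; exact: (cvg_dot (cf p) (cf p)).
have cNs (c : R) (f : 'rV[R]_n * 'rV[R]_n -> 'rV[R]_n) : continuous f ->
    continuous (fun p => c * dot (f p) (f p)).
  move=> cf p; apply: (@continuousM _ _ (fun=> c) (fun p => dot (f p) (f p)) p).
    exact: cst_continuous.
  exact: cN.
have cfst : continuous (fun p : 'rV[R]_n * 'rV[R]_n => p.1) by move=> p; exact: cvg_fst.
have csnd : continuous (fun p : 'rV[R]_n * 'rV[R]_n => p.2) by move=> p; exact: cvg_snd.
have ccst (b : 'rV[R]_n) : continuous (fun _ : 'rV[R]_n * 'rV[R]_n => b).
  exact: cst_continuous.
have cE1 : continuous (fun p : 'rV[R]_n * 'rV[R]_n => E1 p.1).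
  move=> p; apply: (@continuous_comp _ _ _ (fun p : 'rV[R]_n * 'rV[R]_n => p.1) E1).
    exact: cfst.
  exact: (enorm_lipschitz_continuous L0 E1L).
have cE2 : continuous (fun p : 'rV[R]_n * 'rV[R]_n => E2 p.2).
  move=> p; apply: (@continuous_comp _ _ _ (fun p : 'rV[R]_n * 'rV[R]_n => p.2) E2).
    exact: csnd.
  exact: (enorm_lipschitz_continuous L0 E2L).
have cPhi : continuous Phi.
  exact: (cB _ _ (cB _ _ (cB _ _ (cB _ _ cE2 cE1) (cNs beta _ (cBv _ _ cfst (ccst x1))))
    (cN _ (cBv _ _ cfst (ccst xh)))) (cNs q _ (cBv _ _ (cBv _ _ cfst csnd) (ccst _)))).
pose K2 := [set x | enorm (x - xh) <= 1] `*` [set x | enorm (x - xh) <= 1].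
have cK2 : compact K2 by apply: compact_setX; exact: enorm_ball_compact.
have hK : K2 (xh, xh - eps *: eta).
  split; rewrite /= ?subrr ?enorm0 //.
  by rewrite addrAC subrr add0r enormN enormZ gtr0_norm // -/K; nra.
have [[x y] xyK xymax] := compact_EVT_max (ex_intro _ _ hK) cK2
  (continuous_subspaceT cPhi).
rewrite inE in xyK; case: xyK => /= xK yK.
have {}xymax p : K2 p -> Phi p <= Phi (x, y) by move=> pK; apply: xymax; rewrite inE.
set w := x - y - eps *: eta.
have := xymax _ hK; rewrite /Phi /z /= -/w.
have -> : xh - (xh - eps *: eta) - eps *: eta = 0.
  by apply/rowP => i; rewrite !mxE; ring.
rewrite subrr dot0l mulr0 !subr0 => hmax.
(* The competitor [(xh, xh - eps *: eta)] annihilates both added penalties. The Lipschitz bound on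
   [E2] pays [K * eps] twice: for the shifted competitor and for the distance from [y] to [x]. *)
have key : dot (x - xh) (x - xh) + q * dot w w <= L * (enorm w + 2 * K * eps).
  have h1 := E2L xh (xh - eps *: eta); have h2 := E2L y x; have h3 := xhmax x.
  have h4 : enorm (y - x) <= enorm w + K * eps.
    have -> : y - x = - w - eps *: eta by apply/rowP => i; rewrite /w !mxE; ring.
    by rewrite (le_trans (enorm_triangleB _ _)) // enormN enormZ gtr0_norm // mulrC.
  have h5 : enorm (xh - (xh - eps *: eta)) = K * eps.
    by rewrite opprB addrC subrK enormZ gtr0_norm // mulrC.
  move: h1; rewrite h5 ler_norml => /andP[h1 h1']; move: h2; rewrite ler_norml => /andP[h2 h2'].
  have h6 : L * enorm (y - x) <= L * (enorm w + K * eps) by rewrite ler_pM2l.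
  lra.
have Nx0 := dot_ge0 (x - xh).
have wk : enorm w <= k0 * eps.
  rewrite leNgt; apply/negP => wk.
  have qk : q * (k0 * eps) ^+ 2 = 2 * B * eps.
    by rewrite /q /D; field; rewrite !gt_eqF.
  have kew : 0 < k0 * eps by rewrite mulr_gt0.
  have h1 : q * (k0 * eps) * enorm w <= q * dot w w.
    by rewrite -enorm_sqr expr2 (mulrA q (enorm w)) ler_pM2r ?(lt_trans kew) // ler_pM2l // ltW.
  have h2 : L * (enorm w + 2 * K * eps) * k0 <= B * enorm w.
    have : 0 <= (L * K) * (enorm w - k0 * eps).
      by apply: mulr_ge0; [apply: mulr_ge0 => //; exact: ltW|rewrite subr_ge0 ltW].
    by rewrite /B; lra.
  have h3 : (q * (k0 * eps) * enorm w) * k0 <= B * enorm w.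
    by apply: le_trans h2; rewrite ler_pM2r //; lra.
  have h4 : (q * (k0 * eps) * enorm w) * k0 = 2 * B * enorm w.
    by rewrite /q /D; field; rewrite !gt_eqF.
  have : 0 < B * enorm w by rewrite mulr_gt0 // (lt_trans kew).
  lra.
have xs : enorm (x - xh) <= sigma.
  rewrite -(@ler_pXn2r _ 2) ?nnegrE ?enorm_ge0 ?(ltW s0) // enorm_sqr.
  apply: le_trans epsB.
  have h : L * (enorm w + 2 * K * eps) <= L * (k0 * eps + 2 * K * eps).
    by rewrite ler_pM2l // lerD2r.
  have h' : 0 <= q * dot w w by apply: mulr_ge0; [exact: ltW|exact: dot_ge0].
  by rewrite /B; lra.
have xys : enorm (x - y) <= sigma.
  have -> : x - y = w + eps *: eta by rewrite /w subrK.
  apply: le_trans (enorm_triangle _ _) _.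
  by rewrite enormZ (gtr0_norm eps0) -/K; lra.
have ys : enorm (y - xh) <= 2 * sigma.
  have := enorm_dist_triangle x y xh; rewrite (enormC y x); lra.
exists eps, q, x, y; rewrite -/w; split=> //.
- split; [exact: eps0|exact: ltW|].
  have : 0 <= K * eps by rewrite mulr_ge0 // ltW.
  lra.
- split=> //; have -> : 2 * L * (k0 + 2 * enorm eta) / k0 = q * (k0 * eps).
    by rewrite /q /D /B /K; field; rewrite !gt_eqF.
  by rewrite ler_pM2l.
- move=> x' x'x.
  have : K2 (x', y).
    split=> //=; have := enorm_dist_triangle x x' xh; lra.
  move=> /xymax; rewrite /Phi /z /= -/w.
  have h1 := sqr_dist_expand x x' x1; have h2 := sqr_dist_expand x x' xh.
  have h3 := sqr_dist_expand x x' (y + eps *: eta).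
  move: h3; rewrite !opprD !addrA -/w => h3.
  rewrite !dotDl !dotZl in h1 h2 h3 *; nra.
(* Here [sigma <= 4^-1] is needed in full: [2 * sigma + 2^-1 <= 1] keeps [y'] in the ball over which
   the maximum was taken. *)
- move=> y' y'y.
  have : K2 (x, y').
    split=> //=; have := enorm_dist_triangle y y' xh; lra.
  move=> /xymax; rewrite /Phi /z /= -/w.
  have -> : x - y' - eps *: eta = w - (y' - y).
    by apply/rowP => i; rewrite /w !mxE; ring.
  set v := y' - y.
  by rewrite (dot_sqrB w v) dotZl => h; lra.
Qed.

End Doubling.

(** * Comparison of the two arrival times *)

Section ArrivalComparison.
Context {R : realType} {n : nat}.
Local Notation E := ('rV[R]_n * R)%type.

Lemma expRN_lipschitz (s t : R) : 0 <= s -> 0 <= t -> `|expR (- s) - expR (- t)| <= `|s - t|.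
Proof.
wlog st : s t / s <= t.
  move=> H s0 t0; have [st|/ltW st] := leP s t; first exact: H.
  by rewrite distrC (distrC s); exact: H.
move=> s0 t0; rewrite ger0_norm ?subr_ge0 ?ler_expR ?lerN2 //.
rewrite distrC ger0_norm ?subr_ge0 //.
have -> : expR (- t) = expR (- s) * expR (s - t) by rewrite -expRD; congr expR; ring.
have h := expR_ge1Dx (s - t); have es := expR_gt0 (- s).
have es1 : expR (- s) <= 1 by rewrite -expR0 ler_expR oppr_le0.
by nra.
Qed.

(** Both slopes contain the doubling slope [p]. They differ by the localizing slopes, of which
    [2 * s ^+ 2 * |xh - x1| <= 2 * s] is the only part not proportional to [sigma]. *)
Lemma slope_estimate (p b1 b2 x x1 xh : 'rV[R]_n) (s sigma D : R) :
  0 < s -> 0 < sigma <= 1 -> s * enorm (xh - x1) <= 1 -> enorm (x - xh) <= sigma ->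
  enorm p <= D -> enorm (b1 - (p + (2 * s ^+ 2) *: (x - x1) + 2 *: (x - xh))) <= sigma ->
  enorm (b2 - p) <= sigma ->
  enorm b2 <= enorm b1 + (2 * s + (2 * s ^+ 2 + 4) * sigma) /\
  enorm b1 <= D + 2 * s + 2 * s ^+ 2 + 3.
Proof.
move=> s0 /andP[sg0 sg1] sxh xxh pD; set b := p + _ + _ => b1b b2p.
have s20 : 0 < s ^+ 2 by rewrite exprn_gt0.
have bp : enorm (b - p) <= 2 * s + 2 * s ^+ 2 * sigma + 2 * sigma.
  have -> : b - p = (2 * s ^+ 2) *: (x - x1) + 2 *: (x - xh).
    by apply/rowP => i; rewrite /b !mxE; ring.
  apply: le_trans (enorm_triangle _ _) _; rewrite !enormZ !gtr0_norm ?mulr_gt0 //.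
  have h1 : enorm (x - x1) <= sigma + enorm (xh - x1).
    by apply: le_trans (enorm_dist_triangle xh x x1) _; rewrite lerD2r.
  have h2 : s ^+ 2 * enorm (x - x1) <= s ^+ 2 * (sigma + enorm (xh - x1)) by rewrite ler_pM2l.
  have h3 : s * (s * enorm (xh - x1)) <= s * 1 by rewrite ler_pM2l.
  by clear -h2 h3 xxh; rewrite expr2 in h2 *; lra.
have s2sg : s ^+ 2 * sigma <= s ^+ 2 * 1 by rewrite ler_pM2l.
split.
  have -> : b2 = b1 + (b2 - p - (b1 - b) - (b - p)) by apply/rowP => i; rewrite !mxE; ring.
  have h1 := enorm_triangle b1 (b2 - p - (b1 - b) - (b - p)).
  have h2 := enorm_triangleB (b2 - p - (b1 - b)) (b - p).
  have h3 := enorm_triangleB (b2 - p) (b1 - b).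
  by clear -h1 h2 h3 bp b1b b2p; lra.
have -> : b1 = p + (b - p) + (b1 - b) by apply/rowP => i; rewrite !mxE; ring.
have h1 := enorm_triangle (p + (b - p)) (b1 - b).
have h2 := enorm_triangle p (b - p).
by clear -h1 h2 s2sg bp b1b pD sg1; lra.
Qed.

(** Splits [hi * a2 - lo * a1] as [hi * (a2 - a1) + (hi - lo) * a1]; the first term needs [0 <= hi],
    which follows from [0 < e2 <= hi * a2]. *)
Lemma hamiltonian_gap (lo hi M C a1 a2 d J e1 e2 delta : R) :
  0 <= a1 -> 0 <= a2 -> 0 <= d -> 0 < C -> 0 <= delta -> 0 < e2 -> hi <= M ->
  hi <= lo + C * delta -> a2 <= a1 + d -> a1 <= J ->
  lo * a1 <= e1 -> e2 <= hi * a2 -> e2 - e1 <= M * d + C * delta * J.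
Proof.
move=> a10 a20 d0 C0 delta0 e20 hiM hilo a12 a1J lo1 hi2.
have hi0 : 0 <= hi.
  rewrite leNgt; apply/negP => hneg.
  have : hi * a2 <= 0 by rewrite nmulr_rle0.
  by rewrite leNgt (lt_le_trans e20).
have h1 : hi * a2 <= hi * (a1 + d) by rewrite ler_wpM2l.
have h2 : hi * d <= M * d by rewrite ler_wpM2r.
have h3 : hi * a1 <= (lo + C * delta) * a1 by rewrite ler_wpM2r.
have h4 : C * delta * a1 <= C * delta * J by rewrite ler_wpM2l // mulr_ge0 // ltW.
by clear -h1 h2 h3 h4 lo1 hi2; lra.
Qed.

(* [beta |D S| <= 1] in the form given by the front: the inequality holds at points
   near the contact point, so no semicontinuity of [beta] is needed.  It is written
   for [1 - exp (- S)], which turns the equation into one with a zeroth order term. *)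
Definition eikonal_sub (beta S : 'rV[R]_n -> R) : Prop :=
  forall x0 b (a r0 r : R), 0 < S x0 -> 0 < r0 -> 0 < r ->
  (forall x, enorm (x - x0) <= r0 ->
    expR (- S x0) - expR (- S x) <= dot b (x - x0) + a * dot (x - x0) (x - x0)) ->
  exists x t b', [/\ enorm (x - x0) < r, `|t - S x0| < r,
    enorm (b' - b) <= r & beta x * enorm b' <= expR (- t)].

Definition eikonal_super (beta T : 'rV[R]_n -> R) : Prop :=
  forall x0 b (a r0 r : R), 0 < T x0 -> 0 < r0 -> 0 < r ->
  (forall x, enorm (x - x0) <= r0 ->
    dot b (x - x0) + a * dot (x - x0) (x - x0) <= expR (- T x0) - expR (- T x)) ->
  exists x t b', [/\ enorm (x - x0) < r, `|t - T x0| < r,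
    enorm (b' - b) <= r & expR (- t) <= beta x * enorm b'].

(** Apart from [2 * s * M], every term of the bound tends to 0 with [sigma], all other data being
    fixed. *)
Lemma comparison_at_scale (S T lo hi : 'rV[R]_n -> R) (L M C c0 rc s sigma : R)
    (x1 xh eta : 'rV[R]_n) :
  0 < L -> (forall x y, `|S x - S y| <= L * enorm (x - y)) ->
  (forall x y, `|T x - T y| <= L * enorm (x - y)) ->
  (forall x, 0 <= S x) -> (forall x, 0 <= T x) ->
  eikonal_sub lo S -> eikonal_super hi T -> (forall x, hi x <= M) ->
  0 < s -> s * enorm (xh - x1) <= 1 ->
  (forall x, expR (- T x) - expR (- S x) - s ^+ 2 * dot (x - x1) (x - x1) <=
     expR (- T xh) - expR (- S xh) - s ^+ 2 * dot (xh - x1) (xh - x1)) ->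
  0 < c0 -> 0 < C ->
  (forall x y eps, 0 < eps -> enorm (x - xh) < rc -> enorm (y - xh) < rc ->
    enorm (x - y - eps *: eta) <= c0 * eps -> hi y <= lo x + C * enorm (x - y)) ->
  0 < sigma <= 4^-1 -> sigma <= rc / 8 -> sigma * (4 * (L + 1)) <= T xh -> T xh < S xh ->
  expR (- T xh) - expR (- S xh) <= (3 * L + 2) * sigma +
    M * (2 * s + (2 * s ^+ 2 + 4) * sigma) +
    C * (2 * sigma) * (8 * L * (c0 / 2 + 2 * enorm eta) / c0 + 2 * s + 2 * s ^+ 2 + 3).
Proof.
move=> L0 SL TL Sge0 Tge0 sub super hiM s0 sxh xhmax c00 C0 cross sg sgrc sgT TSh.
pose E1 x := expR (- S x); pose E2 x := expR (- T x).
have E1L : enorm_lipschitz L E1.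
  by move=> x y; apply: le_trans (SL x y); exact: expRN_lipschitz.
have E2L : enorm_lipschitz L E2.
  by move=> x y; apply: le_trans (TL x y); exact: expRN_lipschitz.
(* The other half of the opening absorbs the passage from [x], [y] to the points where the
   inequalities hold: each moves by less than [r = k0 * eps / 2], and
   [k0 * eps + 2 * r = c0 * eps]. *)
pose k0 := c0 / 2; have k00 : 0 < k0 by rewrite divr_gt0.
have [eps [q [x [y [[eps0 q0 keps] [xxh yxh xy] [wk qw] subx supy]]]]] :=
  doubling_point eta L0 (sqr_ge0 s) k00 sg E1L E2L xhmax.
set w := x - y - eps *: eta in wk qw subx supy.
have /andP[sg0 sg4] := sg.
pose r := k0 * eps / 2.
have r0 : 0 < r by rewrite divr_gt0 // mulr_gt0.
have rsg : r <= sigma / 2 by clear -keps; rewrite /r; lra.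
have half0 : 0 < 2^-1 :> R by rewrite invr_gt0.
have Lsg : 0 < L * sigma by rewrite mulr_gt0.
have Lx : L * enorm (x - xh) <= L * sigma by rewrite ler_pM2l.
have Ly : L * enorm (y - xh) <= L * (2 * sigma) by rewrite ler_pM2l.
(* The bound of [sigma] by [T xh] makes both arrival times positive, as the eikonal inequalities
   require, with a margin that keeps [t1] and [t2] nonnegative. *)
have Sx : L * sigma + sigma <= S x.
  have := SL x xh; rewrite ler_norml => /andP[h _].
  by clear -h Lx Lsg sg0 sgT TSh; lra.
have Ty : sigma <= T y.
  have := TL y xh; rewrite ler_norml => /andP[h _].
  by clear -h Ly Lsg sg0 sgT; lra.
have Sx0 : 0 < S x by clear -Sx Lsg sg0; lra.
have Ty0 : 0 < T y by clear -Ty sg0; lra.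
have [x' [t1 [b1 [x'x t1S b1b lo1]]]] := sub _ _ _ _ _ Sx0 half0 r0 subx.
have [y' [t2 [b2 [y'y t2T b2p hi2]]]] := super _ _ _ _ _ Ty0 half0 r0 supy.
have rsg' : r <= sigma by clear -rsg sg0; lra.
have t10 : 0 <= t1.
  by move: t1S; rewrite ltr_norml => /andP[h _]; clear -h rsg' Sx Lsg; lra.
have t20 : 0 <= t2.
  by move: t2T; rewrite ltr_norml => /andP[h _]; clear -h rsg' Ty; lra.
have e1 : expR (- t1) <= E1 xh + L * sigma + sigma.
  have := expRN_lipschitz t10 (ltW Sx0); have := E1L x xh.
  rewrite -/(E1 x) !ler_norml => /andP[_ h1] /andP[_ h2].
  by clear -h1 h2 Lx t1S rsg'; lra.
have e2 : E2 xh - 2 * (L * sigma) - sigma <= expR (- t2).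
  have := expRN_lipschitz t20 (ltW Ty0); have := E2L y xh.
  rewrite -/(E2 y) !ler_norml => /andP[h1 _] /andP[h2 _].
  by clear -h1 h2 Ly t2T rsg'; lra.
have xy' : enorm (x' - y') <= 2 * sigma.
  have h1 := enorm_dist_triangle x x' y'; have h2 := enorm_dist_triangle y x y'.
  by clear -h1 h2 xy x'x y'y rsg; rewrite (enormC y y') in h2; lra.
have hilo : hi y' <= lo x' + C * enorm (x' - y').
  apply: (cross x' y' eps) => //.
  - have h := enorm_dist_triangle x x' xh.
    by clear -h x'x xxh sgrc rsg' sg0; lra.
  - have h := enorm_dist_triangle y y' xh.
    by clear -h y'y yxh sgrc rsg' sg0; lra.
  - have -> : x' - y' - eps *: eta = w + (x' - x) - (y' - y).
      by clear; apply/rowP => i; rewrite /w !mxE; ring.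
    have h1 := enorm_triangleB (w + (x' - x)) (y' - y).
    have h2 := enorm_triangle w (x' - x).
    by clear -wk x'x y'y h1 h2; rewrite /r /k0 in wk x'x y'y; lra.
have pD : enorm ((2 * q) *: w) <= 8 * L * (k0 + 2 * enorm eta) / c0.
  have -> : 8 * L * (k0 + 2 * enorm eta) / c0 = 2 * (2 * L * (k0 + 2 * enorm eta) / k0).
    by rewrite /k0; field; rewrite !gt_eqF.
  by rewrite enormZ ger0_norm ?mulr_ge0 // -(mulrA 2 q) ler_pM2l.
have sg1 : 0 < sigma <= 1 by rewrite sg0 /=; clear -sg4; lra.
have [d12 b1J] := slope_estimate s0 sg1 sxh xxh pD (le_trans b1b rsg') (le_trans b2p rsg').
have d0 : 0 <= 2 * s + (2 * s ^+ 2 + 4) * sigma.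
  by have h := mulr_ge0 (sqr_ge0 s) (ltW sg0); clear -h s0 sg0; lra.
have hilo' : hi y' <= lo x' + C * (2 * sigma).
  by apply: (le_trans hilo); rewrite lerD2l ler_pM2l.
have sg2 : 0 <= 2 * sigma by rewrite mulr_ge0 // ltW.
have := hamiltonian_gap (enorm_ge0 b1) (enorm_ge0 b2) d0 C0 sg2 (expR_gt0 _) (hiM y')
  hilo' d12 b1J lo1 hi2.
rewrite -/(E1 xh) -/(E2 xh) -/k0.
set J := _ + 3; set d := M * _ => gap.
by clear -gap e1 e2; lra.
Qed.

Lemma last_arrival_le_first (rho : R) (G Om : set 'rV[R]_n)
    (n1 n2 alpha : 'rV[R]_n -> R) (u : E -> R) y0 :
  0 < rho -> piecewise_lipschitz_velocity rho G Om n1 n2 alpha ->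
  {within closed_half, continuous u} ->
  viscosity_subsolution (lsc_envelope alpha) u ->
  viscosity_supersolution (usc_envelope alpha) u ->
  u (y0, 0) < 0 ->
  (forall x, u (x, 0) <= 0 -> last_arrival u x <= 0) ->
  forall x, last_arrival u x <= first_arrival u x.
Proof.
move=> rho0 vel cu usub usup uy0 init x1.
have ucone x y s t : 0 <= s <= t -> enorm (x - y) <= rho * (t - s) -> u (x, t) <= u (y, s).
  exact: subsolution_cone (lsc_velocity_ge_rho vel) cu usub.
have SL := last_arrival_lipschitz rho0 ucone uy0.
have TL := first_arrival_lipschitz rho0 ucone uy0.
have Sge0 := last_arrival_ge0 rho0 ucone uy0.
have Tge0 := first_arrival_ge0 rho0 ucone uy0.
have Tval := first_arrival_value rho0 cu ucone uy0.
have sub : eikonal_sub (lsc_envelope alpha) (last_arrival u).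
  by move=> x0 b a r0 r; exact: (last_arrival_subsolution rho0 cu ucone uy0 usub).
have super : eikonal_super (usc_envelope alpha) (first_arrival u).
  by move=> x0 b a r0 r; exact: (first_arrival_supersolution rho0 cu ucone uy0 usup).
set S := last_arrival u in init SL Sge0 sub *.
set T := first_arrival u in TL Tge0 Tval super *.
pose E1 x := expR (- S x); pose E2 x := expR (- T x).
pose L := rho^-1; have L0 : 0 < L by rewrite invr_gt0.
have lip (f : 'rV[R]_n -> R) : (forall x y, rho * (f x - f y) <= enorm (x - y)) ->
    forall x y, `|f x - f y| <= L * enorm (x - y).
  move=> fL x y.
  have fB z z' : f z - f z' <= L * enorm (z - z').
    by rewrite /L ler_pdivlMl.
  by have := fB y x; have := fB x y; rewrite ler_norml enormC; lra.
have {}SL := lip _ SL; have {}TL := lip _ TL.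
have E1L : enorm_lipschitz L E1.
  by move=> x y; apply: le_trans (SL x y); exact: expRN_lipschitz.
have E2L : enorm_lipschitz L E2.
  by move=> x y; apply: le_trans (TL x y); exact: expRN_lipschitz.
rewrite leNgt; apply/negP => TS1.
have [M M0 uscM] := usc_velocity_bounded vel.
pose F x := E2 x - E1 x.
set m0 := F x1.
have m00 : 0 < m0 by rewrite subr_gt0 ltr_expR ltrN2.
have F1 x : F x <= 1.
  have : E2 x <= 1 by rewrite -expR0 ler_expR oppr_le0.
  by have := expR_gt0 (- S x); rewrite /F /E1; lra.
have cF : continuous F.
  move=> x; exact: (@continuousB R R^o _ E2 E1 x
    (enorm_lipschitz_continuous L0 E2L (x := x)) (enorm_lipschitz_continuous L0 E1L (x := x))).
(* The localization then contributes [M * (2 * s) = m0 / 4] to the gap. *)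
pose s := m0 / (8 * M).
have s0 : 0 < s by rewrite divr_gt0 // mulr_gt0.
have Ms : M * s = m0 / 8 by rewrite /s; field; rewrite gt_eqF.
have [xh [Fxh sxh xhmax]] := penalized_max cF F1 s0 m00.
rewrite -/m0 in Fxh.
have TSh : T xh < S xh.
  by have := lt_le_trans m00 Fxh; rewrite subr_gt0 ltr_expR ltrN2.
(* If [T xh = 0], then [u (xh, 0) <= 0] and the initial condition forces [S xh <= 0], against
   [T xh < S xh]. *)
have Th0 : 0 < T xh.
  rewrite lt_neqAle Tge0 andbT; apply/eqP => T0.
  have := Tval xh; rewrite -T0 => /init.
  by move: TSh; rewrite -T0; lra.
have [eta [c0 [rc [C [c00 rc0 C0 cross]]]]] := velocity_crosses_upward vel xh.
pose J := 8 * L * (c0 / 2 + 2 * enorm eta) / c0 + 2 * s + 2 * s ^+ 2 + 3.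
have s20 : 0 < s ^+ 2 by rewrite exprn_gt0.
have J0 : 0 < J.
  have h : 0 <= 8 * L * (c0 / 2 + 2 * enorm eta) / c0.
    apply: divr_ge0; last exact: ltW.
    apply: mulr_ge0; first by apply: mulr_ge0 => //; exact: ltW.
    by have h := enorm_ge0 eta; clear -h c00; lra.
  by rewrite /J; clear -h s0 s20; lra.
(* [Q] collects the coefficients of [sigma] in the gap, which is then at most
   [m0 / 4 + Q * sigma <= m0 / 2], whereas [m0 <= F xh]. *)
pose Q := (3 * L + 2) + M * (2 * s ^+ 2 + 4) + 2 * C * J.
have Q0 : 0 < Q.
  have h1 := mulr_gt0 C0 J0; have h2 := mulr_gt0 M0 s20.
  by rewrite /Q; clear -h1 h2 L0 M0; lra.
pose sigma := Order.min 4^-1 (Order.min (rc / 8)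
  (Order.min (T xh / (4 * (L + 1))) (m0 / (4 * Q)))).
have L1 : 0 < 4 * (L + 1) by rewrite mulr_gt0 // addr_gt0.
have Q4 : 0 < 4 * Q by rewrite mulr_gt0.
have sg0 : 0 < sigma.
  by rewrite !lt_min; apply/and4P; split; rewrite ?invr_gt0 ?divr_gt0.
have sg : 0 < sigma <= 4^-1 by rewrite sg0 ge_min lexx.
have sgrc : sigma <= rc / 8 by rewrite /sigma !ge_min lexx !orbT.
have sgT : sigma * (4 * (L + 1)) <= T xh.
  by rewrite -ler_pdivlMr // /sigma !ge_min lexx !orbT.
have sgQ : sigma * (4 * Q) <= m0.
  by rewrite -ler_pdivlMr // /sigma !ge_min lexx !orbT.
have := comparison_at_scale L0 SL TL Sge0 Tge0 sub super uscM s0 sxh xhmax c00 C0 cross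
  sg sgrc sgT TSh.
rewrite -/J -/(F xh) => gap.
have Md : M * (2 * s + (2 * s ^+ 2 + 4) * sigma) =
    2 * (m0 / 8) + M * (2 * s ^+ 2 + 4) * sigma by rewrite -Ms; ring.
rewrite Md in gap.
move: gap sgQ Fxh m00; rewrite /Q; clear; move: (sigma) (J) (F xh) (m0) => a b c e.
lra.
Qed.

End ArrivalComparison.

(** * Relative boundaries and the no-interior condition *)

Section ZeroLevelSet.
Context {R : realType} {n : nat}.
Local Notation E := ('rV[R]_n * R)%type.

Lemma nbhs_closed_halfP (p : E) (B : set E) : closed_half p ->
  nbhs (p : subspace (closed_half : set E)) B <->
  exists2 r, 0 < r & forall q, closed_half q -> enorm (q.1 - p.1) < r ->
    `|q.2 - p.2| < r -> B q.
Proof.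
move=> Hp; rewrite [nbhs]/nbhs /= -(nbhs_subspace_in Hp).
split=> [/nbhs_enorm_timeP[r r0 rP]|[r r0 rP]].
  by exists r => // q Hq q1 q2; exact: rP.
by apply/nbhs_enorm_timeP; exists r => // q q1 q2 Hq; exact: rP.
Qed.

(** Points outside the half space are isolated in the subspace topology, so they cannot be limits of
    [A]. *)
Lemma boundary_in_closed_half_sub (A : set E) p : A `<=` closed_half ->
  boundary_in closed_half A p -> closed_half p.
Proof.
move=> AH [clA _]; apply: contrapT => nHp.
have : nbhs (p : subspace (closed_half : set E)) [set p].
  by rewrite [nbhs]/nbhs /= -(nbhs_subspace_out nHp) => _ ->.
by move=> /clA[q [/AH Hq qp]]; apply: nHp; rewrite -qp.
Qed.

(** Continuity alone puts the boundary into the zero set; the converse is the density hypothesis. It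
    serves for both [u] and [- u]. *)
Lemma boundary_in_pos (v : E -> R) :
  {within closed_half, continuous v} ->
  (forall p, closed_half p -> v p = 0 -> forall r, 0 < r ->
    exists q, [/\ closed_half q, 0 < v q, enorm (q.1 - p.1) < r & `|q.2 - p.2| < r]) ->
  boundary_in closed_half [set p | closed_half p /\ 0 < v p] =
  [set p | closed_half p /\ v p = 0].
Proof.
move=> cv dense; apply/seteqP; split=> p.
  move=> bp; have Hp : closed_half p.
    by apply: boundary_in_closed_half_sub bp => q [].
  split=> //; case: bp => clp nintp.
  have [vp|vp|//] := ltgtP (v p) 0.
    have nv : 0 < - v p by rewrite oppr_gt0.
    have [r r0 rP] := within_continuous_enorm cv Hp nv.
    have /clp[q [[Hq vq] qB]] : nbhs (p : subspace (closed_half : set E))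
        [set q | closed_half q -> v q < 0].
      apply/nbhs_closed_halfP => //; exists r => // q Hq q1 q2 _.
      by have := rP q Hq q1 q2; rewrite ltr_norml => /andP[? ?]; lra.
    by have := qB Hq; rewrite ltNge ltW.
  have [r r0 rP] := within_continuous_enorm cv Hp vp.
  case: nintp; apply/nbhs_closed_halfP => //; exists r => // q Hq q1 q2; split=> //.
  by have := rP q Hq q1 q2; rewrite ltr_norml => /andP[? ?]; lra.
move=> [Hp vp]; split.
  move=> B /(nbhs_closed_halfP _ Hp)[r r0 rB].
  have [q [Hq vq q1 q2]] := dense p Hp vp r r0.
  by exists q; split=> //; exact: rB.
by move=> /(nbhs_subspace_singleton (p := p)) [_]; rewrite vp ltxx.
Qed.

End ZeroLevelSet.

Theorem theorem4p1 (R : realType) (n : nat) (hn : (0 < n)%N)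
  (rho : R) (hrho : 0 < rho)
  (G Om : set 'rV[R]_n) (n1 n2 alpha : 'rV[R]_n -> R)
  (halpha : piecewise_lipschitz_velocity rho G Om n1 n2 alpha)
  (u0 : 'rV[R]_n -> R) (hu0 : continuous u0)
  (hpos : [set x | 0 < u0 x] !=set0)
  (hneg : [set x | u0 x < 0] !=set0)
  (hzero_pos : [set x | u0 x = 0] = boundary [set x | 0 < u0 x])
  (hpos_neg : boundary [set x | 0 < u0 x] = boundary [set x | u0 x < 0])
  (u : 'rV[R]_n * R -> R) (hu : cauchy_viscosity_solution alpha u0 u) :
  let Q := closed_half : set ('rV[R]_n * R) in
  [set p | Q p /\ u p = 0] = boundary_in Q [set p | Q p /\ 0 < u p] /\
  boundary_in Q [set p | Q p /\ 0 < u p] =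
    boundary_in Q [set p | Q p /\ u p < 0].
Proof.
move=> Q; case: hu => cu usub usup uinit.
have hneg_bd : [set x | u0 x = 0] = boundary [set x | u0 x < 0] by rewrite hzero_pos.
case: hneg => y0 /=; rewrite -uinit => uy0.
have ucone x y s t : 0 <= s <= t -> enorm (x - y) <= rho * (t - s) -> u (x, t) <= u (y, s).
  exact: subsolution_cone (lsc_velocity_ge_rho halpha) cu usub.
have neg_arrival y : u0 y < 0 -> last_arrival u y <= 0.
  by move=> uy; apply: (@arrival_le _ _ [set p | u p < 0]) => //=; rewrite uinit.
have init x : u (x, 0) <= 0 -> last_arrival u x <= 0.
  rewrite uinit le_eqVlt => /predU1P[ux|]; last exact: neg_arrival.
  apply/ler_addgt0Pr => e e0; rewrite add0r.
  (* A zero of [u0] is a limit of points where [u0 < 0] and the last arrival is at most 0; the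
     Lipschitz bound carries this to the limit. *)
  have [clx _] : boundary [set x | u0 x < 0] x by rewrite -hneg_bd.
  have [y [uy yx]] := clx _ (nbhs_enorm_ball x (mulr_gt0 hrho e0)).
  have h1 := last_arrival_lipschitz hrho ucone uy0 x y; have h2 := neg_arrival y uy.
  rewrite -(ler_pM2l hrho); move: yx => /=; rewrite enormC => yx.
  have h3 : rho * last_arrival u y <= 0 by rewrite pmulr_rle0.
  by rewrite mulrBr in h1; lra.
have ST x := last_arrival_le_first hrho halpha cu usub usup uy0 init x.
have H0 (x : 'rV[R]_n) t : closed_half (x, t) = (0 <= t) by [].
have pos_dense p : closed_half p -> u p = 0 -> forall r, 0 < r ->
    exists q, [/\ closed_half q, 0 < u q, enorm (q.1 - p.1) < r & `|q.2 - p.2| < r].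
  case: p => x t; rewrite H0 => t0 uxt r r0.
  (* At t = 0 there is no earlier time, and positive points come from the initial datum. For t > 0,
     a zero gives t <= S x <= T x, so [u] is positive just before t. *)
  move: t0; rewrite le_eqVlt => /predU1P[t0|t0].
    rewrite -t0 in uxt *; have [clx _] : boundary [set x | 0 < u0 x] x by rewrite -hzero_pos /= -uinit.
    have [y [uy yx]] := clx _ (nbhs_enorm_ball x r0).
    exists (y, 0); rewrite /= uinit subrr normr0; split=> //.
    by rewrite H0.
  pose e := Order.min (t / 2) (r / 2).
  have e0 : 0 < e by rewrite lt_min !divr_gt0.
  have et : e <= t / 2 by rewrite ge_min lexx.
  have er : e <= r / 2 by rewrite ge_min lexx orbT.
  exists (x, t - e); rewrite H0 /= subrr enorm0; split=> //; first by lra.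
    apply: first_arrival_gt; apply/andP; split; first by lra.
    apply: lt_le_trans (ST x).
    have utge : 0 <= u (x, t) by rewrite uxt.
    by have := le_last_arrival hrho ucone uy0 utge; lra.
  by rewrite addrAC subrr add0r normrN gtr0_norm //; lra.
have neg_dense p : closed_half p -> - u p = 0 -> forall r, 0 < r ->
    exists q, [/\ closed_half q, 0 < - u q, enorm (q.1 - p.1) < r & `|q.2 - p.2| < r].
  case: p => x t; rewrite H0 => t0 /eqP; rewrite oppr_eq0 => /eqP uxt r r0.
  (* A zero gives S x <= T x <= t, so [u] is negative just after t; later times exist also at t =
     0. *)
  exists (x, t + r / 2); rewrite H0 /= subrr enorm0; split=> //; first by lra.
    rewrite oppr_gt0; apply: (last_arrival_lt hrho ucone uy0).
    apply: (le_lt_trans (ST x)).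
    have : first_arrival u x <= t by apply: first_arrival_le => //; rewrite uxt.
    lra.
  by rewrite (addrC t) addrK gtr0_norm ?divr_gt0 //; lra.
have cnu : {within closed_half, continuous (fun p => - u p)}.
  by move=> p; apply: continuousN; exact: cu.
have bpos := boundary_in_pos cu pos_dense.
have := boundary_in_pos cnu neg_dense.
have -> : [set p | closed_half p /\ 0 < - u p] = [set p | Q p /\ u p < 0].
  by apply/seteqP; split=> p []; rewrite ?oppr_gt0 //= oppr_gt0.
have -> : [set p | closed_half p /\ - u p = 0] = [set p | Q p /\ u p = 0].
  apply/seteqP; split=> p [Hp] /eqP; rewrite ?oppr_eq0 => /eqP up; split=> //.
  by rewrite up oppr0.
by move=> bneg; rewrite bneg -bpos.
Qed.
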